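(* For every formal volume form $\nu=h\mu$ with $h\in\mathcal{R}$, $h(0)>0$, the Poisson structure $\pi_\nu$ is formally equivalent to a Poisson structure $\pi_{\mu_p}$ obtained from a volume form $$\mu_p=(c+p)\mu,$$ for some $c\in\mathbb{R}$ with $c>0$ and some $p$ in the ideal $\langle f_1,f_2\rangle$ of $\mathbb{R}[[f_1,f_2]]$. Conversely, every such pair $(c,p)$ occurs, i.e. $(c+p)\mu$ is a formal volume form with positive constant term.
   Context: Let $x_1,\dots,x_4$ be the coordinates on $\mathbb{R}^4$, $\mu=dx_1\wedge dx_2\wedge dx_3\wedge dx_4$, $f_1=x_1^2-x_2^2+x_3^2-x_4^2$, $f_2=2(x_1x_2+x_3x_4)$, $\mathcal{R}=\mathbb{R}[[x_1,x_2,x_3,x_4]]$. $\mathbb{R}[[f_1,f_2]]\subset\mathcal{R}$ is the subring of power series in $f_1,f_2$. For a (formal) volume form $\nu=h\mu$ with $h\in\mathcal{R}$, $h(0)>0$, the (formal) Poisson bivector $\pi_\nu$ is defined by $\pi_\nu(dg,dk)\,\nu=dg\wedge dk\wedge df_1\wedge df_2$ for all $g,k\in\mathcal{R}$; thus $\pi_\nu=h^{-1}\pi$ with $\pi=\pi_\mu$. (Formal volume forms of this type are the infinite Taylor series at $0$ of smooth volume forms on $\mathbb{R}^4$ that define the standard orientation.) A formal diffeomorphism is a $4$-tuple of elements of $\mathcal{R}$ without constant term and with invertible linear part; it acts by pull-back on formal multivector fields. Two formal Poisson structures $\pi',\pi''$ are formally equivalent if $\phi^*\pi'=\pi''$ for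 some formal diffeomorphism $\phi$. *)

(* Defs.v *)
From HB Require Import structures.
From mathcomp Require Import all_boot all_order all_algebra.
From mathcomp Require Import boolp reals.
From mathcomp Require Import mpoly ring.

Set Implicit Arguments.
Unset Strict Implicit.
Unset Printing Implicit Defensive.

Import Order.TTheory GRing.Theory Num.Theory.
Local Open Scope ring_scope.

Record fps (n : nat) (R : Type) : Type := Fps { fcoef : 'X_{1..n} -> R }.

Arguments Fps {n R} fcoef.
Arguments fcoef {n R} f m.

Lemma fpsP n (R : Type) (f g : fps n R) : fcoef f =1 fcoef g <-> f = g.
Proof.
split=> [|->//]; case: f g => [f] [g] /= fg.
by congr Fps; apply/funext.
Qed.

HB.instance Definition _ n (R : Type) := gen_eqMixin (fps n R).
HB.instance Definition _ n (R : Type) := gen_choiceMixin (fps n R).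

Section Ring.
Variables (n : nat) (R : comNzRingType).
Implicit Types (f g h : fps n R) (m : 'X_{1..n}).

Definition fps_zero : fps n R := Fps (fun=> 0).
Definition fps_opp f : fps n R := Fps (fun m => - fcoef f m).
Definition fps_add f g : fps n R := Fps (fun m => fcoef f m + fcoef g m).

Lemma fps_addA : associative fps_add.
Proof. by move=> f g h; apply/fpsP => m /=; rewrite addrA. Qed.
Lemma fps_addC : commutative fps_add.
Proof. by move=> f g; apply/fpsP => m /=; rewrite addrC. Qed.
Lemma fps_add0 : left_id fps_zero fps_add.
Proof. by move=> f; apply/fpsP => m /=; rewrite add0r. Qed.
Lemma fps_addN : left_inverse fps_zero fps_opp fps_add.
Proof. by move=> f; apply/fpsP => m /=; rewrite addNr. Qed.

HB.instance Definition _ :=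
  GRing.isZmodule.Build (fps n R) fps_addA fps_addC fps_add0 fps_addN.

Definition fpsC (c : R) : fps n R := Fps (fun m => if m == 0%MM then c else 0).
Definition fpsX (i : 'I_n) : fps n R := Fps (fun m => (m == U_(i)%MM)%:R).

(* The bound on [mdeg k] is implied by [k <= m]; it only makes the range of
   summation a finite type. *)
Definition fps_mul f g : fps n R := Fps (fun m =>
  \sum_(k : 'X_{1..n < (mdeg m).+1} | (k <= m)%MM)
     fcoef f k * fcoef g (m - k)%MM).

Definition fps_trunc (d : nat) f : {mpoly R[n]} :=
  \sum_(m : 'X_{1..n < d}) fcoef f m *: 'X_[m].

Definition fps_agree (d : nat) f (p : {mpoly R[n]}) :=
  forall m, (mdeg m < d)%N -> fcoef f m = p@_m.

Lemma fps_truncP d f : fps_agree d f (fps_trunc d f).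
Proof. by move=> m md; rewrite mcoeff_mpoly. Qed.

Lemma fps_agreeW d d' f p : (d' <= d)%N -> fps_agree d f p -> fps_agree d' f p.
Proof. by move=> dd fp m md; apply: fp; apply: leq_trans md dd. Qed.

Lemma fps_agreeM d f g p q :
  fps_agree d f p -> fps_agree d g q -> fps_agree d (fps_mul f g) (p * q).
Proof.
move=> fp gq m md /=; rewrite (mcoeff_poly_mul_lin _ _ (ltnSn (mdeg m))).
apply: eq_bigr => k km; rewrite fp ?gq //.
  exact: leq_ltn_trans (mdegB _ _) md.
by apply: leq_ltn_trans md; have := bmdeg k; rewrite ltnS.
Qed.

Lemma fps_agreeD d f g p q :
  fps_agree d f p -> fps_agree d g q -> fps_agree d (f + g) (p + q).
Proof. by move=> fp gq m md /=; rewrite mcoeffD fp ?gq. Qed.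

Lemma fps_agreeC d c : fps_agree d (fpsC c) c%:MP.
Proof.
by move=> m _ /=; rewrite mcoeffC eq_sym; case: eqVneq; rewrite ?mulr1 ?mulr0.
Qed.

Lemma fps_agreeX d i : fps_agree d (fpsX i) 'X_i.
Proof. by move=> m _ /=; rewrite mcoeffX eq_sym. Qed.

Lemma fps_agree_eq f g :
  (forall d, exists2 p, fps_agree d f p & fps_agree d g p) -> f = g.
Proof.
move=> fg; apply/fpsP => m; have [p fp gp] := fg (mdeg m).+1.
by rewrite fp ?gp.
Qed.

Lemma fps_mulA : associative fps_mul.
Proof.
move=> f g h; apply: fps_agree_eq => d.
exists (fps_trunc d f * (fps_trunc d g * fps_trunc d h)).
  by do !apply: fps_agreeM; apply: fps_truncP.
by rewrite mulrA; do !apply: fps_agreeM; apply: fps_truncP.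
Qed.

Lemma fps_mulC : commutative fps_mul.
Proof.
move=> f g; apply: fps_agree_eq => d.
exists (fps_trunc d f * fps_trunc d g); last rewrite mulrC.
  by apply: fps_agreeM; apply: fps_truncP.
by apply: fps_agreeM; apply: fps_truncP.
Qed.

Lemma fps_mul1 : left_id (fpsC 1) fps_mul.
Proof.
move=> f; apply: fps_agree_eq => d; exists (1%:MP * fps_trunc d f).
  by apply: fps_agreeM; [apply: fps_agreeC|apply: fps_truncP].
by rewrite mul1r; apply: fps_truncP.
Qed.

Lemma fps_mulDl : left_distributive fps_mul +%R.
Proof.
move=> f g h; apply: fps_agree_eq => d.
exists ((fps_trunc d f + fps_trunc d g) * fps_trunc d h).
  by apply: fps_agreeM; [apply: fps_agreeD|]; apply: fps_truncP.
by rewrite mulrDl; apply: fps_agreeD; apply: fps_agreeM; apply: fps_truncP.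
Qed.

Lemma fps_1neq0 : fpsC 1 != 0.
Proof.
apply/eqP => /fpsP/(_ 0%MM) /= /eqP.
by rewrite eqxx oner_eq0.
Qed.

HB.instance Definition _ := GRing.Zmodule_isComNzRing.Build (fps n R)
  fps_mulA fps_mulC fps_mul1 fps_mulDl fps_1neq0.

Lemma fcoef0 m : fcoef (0 : fps n R) m = 0. Proof. by []. Qed.
Lemma fcoefN f m : fcoef (- f) m = - fcoef f m. Proof. by []. Qed.
Lemma fcoefD f g m : fcoef (f + g) m = fcoef f m + fcoef g m.
Proof. by []. Qed.
Lemma fcoef1 m : fcoef (1 : fps n R) m = (m == 0%MM)%:R.
Proof. by rewrite /=; case: eqP. Qed.
Lemma fcoefM f g m : fcoef (f * g) m =
  \sum_(k : 'X_{1..n < (mdeg m).+1} | (k <= m)%MM)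
     fcoef f k * fcoef g (m - k)%MM.
Proof. by []. Qed.
Lemma fcoef_sum I (r : seq I) (P : pred I) (F : I -> fps n R) m :
  fcoef (\sum_(i <- r | P i) F i) m = \sum_(i <- r | P i) fcoef (F i) m.
Proof. exact: (big_morph (fcoef^~ m) (fun f g => fcoefD f g m) (fcoef0 m)). Qed.

Lemma fcoefCM c f m : fcoef (fpsC c * f) m = c * fcoef f m.
Proof.
rewrite (fps_agreeM (@fps_agreeC (mdeg m).+1 c) (@fps_truncP (mdeg m).+1 f))//.
by rewrite mcoeffCM -fps_truncP.
Qed.

Lemma fcoef_mul_eq f g g' m :
    (forall k, (mdeg k <= mdeg m)%N -> fcoef g k = fcoef g' k) ->
  fcoef (f * g) m = fcoef (f * g') m.
Proof.
move=> gg; rewrite !fcoefM; apply: eq_bigr => k _.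
by rewrite gg // mdegB.
Qed.

Lemma fcoef_expr_eq0 f k m :
  fcoef f 0%MM = 0 -> (mdeg m < k)%N -> fcoef (f ^+ k) m = 0.
Proof.
move=> f0; elim: k m => // k IH m mk; rewrite exprS fcoefM big1 // => l lm.
have [->|l0] := eqVneq (l : 'X_{1..n}) 0%MM; first by rewrite f0 mul0r.
rewrite IH ?mulr0 //; apply: leq_trans (mk : (mdeg m <= k)%N).
rewrite -[in X in (_ < X)%N](submK lm) mdegD -[X in (X < _)%N]addn0 ltn_add2l.
by rewrite lt0n mdeg_eq0.
Qed.

Definition fps_deriv (i : 'I_n) f : fps n R :=
  Fps (fun m => fcoef f (m + U_(i))%MM *+ (m i).+1).

(* A formal 1-form is given by its row of coefficients in the basis [dx_j]. *)
Definition differential f : 'rV[fps n R]_n := \row_j fps_deriv j f.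

Lemma fps_agree_deriv d i f p :
  fps_agree d.+1 f p -> fps_agree d (fps_deriv i f) p^`M(i).
Proof.
by move=> fp m md /=; rewrite mcoeff_deriv fp // mdegD mdeg1 addn1.
Qed.

Lemma fps_derivD i f g : fps_deriv i (f + g) = fps_deriv i f + fps_deriv i g.
Proof. by apply/fpsP => m /=; rewrite mulrnDl. Qed.

Lemma fps_derivN i f : fps_deriv i (- f) = - fps_deriv i f.
Proof. by apply/fpsP => m /=; rewrite mulNrn. Qed.

Lemma fps_derivM i f g :
  fps_deriv i (f * g) = fps_deriv i f * g + f * fps_deriv i g.
Proof.
apply: fps_agree_eq => d; set p := fps_trunc d.+1 f; set q := fps_trunc d.+1 g.
have fp : fps_agree d.+1 f p by apply: fps_truncP.
have gq : fps_agree d.+1 g q by apply: fps_truncP.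
exists (p * q)^`M(i); first exact/fps_agree_deriv/fps_agreeM.
rewrite mderivM; apply: fps_agreeD; apply: fps_agreeM;
  by [apply: fps_agree_deriv|apply: (@fps_agreeW d.+1)].
Qed.

Lemma fps_deriv0 i : fps_deriv i 0 = 0.
Proof. by apply/fpsP => m /=; rewrite mul0rn. Qed.

Lemma fps_deriv_nat i k : fps_deriv i k%:R = 0.
Proof.
have D1 : fps_deriv i 1 = 0.
  have := fps_derivM i 1 1; rewrite !mulr1 mul1r.
  by move=> /(congr1 (fun f => f - fps_deriv i 1)); rewrite subrr addrK.
elim: k => [|k IH]; first exact: fps_deriv0.
by rewrite -natr1 fps_derivD IH D1 addr0.
Qed.

Lemma fps_derivX i j : fps_deriv i (fpsX j) = (i == j)%:R.
Proof.
apply: fps_agree_eq => d; exists ('X_j)^`M(i).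
  exact/fps_agree_deriv/fps_agreeX.
rewrite mderivX mnm1E eq_sym; have [<-|_] := eqVneq i j.
  rewrite (_ : U_(i) - U_(i) = 0)%MM ?mpolyX0 ?scale1r.
    exact: fps_agreeC.
  by apply/mnmP => k; rewrite mnmBE subnn mnm0E.
by rewrite scale0r => m _; rewrite mcoeff0.
Qed.

End Ring.

Arguments fpsC {n R} c.
Arguments fpsX {n R} i.

(* [g(phi_1, ..., phi_k)].  When the [phi_i] have no constant term, a monomial
   of degree [> mdeg m] in the [phi_i] does not contribute to the coefficient
   of ['X_[m]], so that the sum below is the whole (infinite) one; the
   definition is meaningless for other [phi]. *)
Definition fps_comp (R : comNzRingType) (k n : nat)
    (g : fps k R) (phi : k.-tuple (fps n R)) : fps n R :=
  Fps (fun m => \sum_(l : 'X_{1..k < (mdeg m).+1})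
    fcoef g l * fcoef (\prod_(i < k) tnth phi i ^+ l i) m).

Section Unit.
Variables (n : nat) (R : fieldType).
Implicit Types (f g : fps n R) (m : 'X_{1..n}).

Definition fps_unit : pred (fps n R) := fun f => fcoef f 0%MM != 0.

(* Geometric series: [f^-1 = a^-1 * \sum_k (1 - a^-1 f)^k] with [a = f(0)]. *)
Definition fps_inv f : fps n R :=
  if fps_unit f then
    let a := fcoef f 0%MM in
    Fps (fun m => \sum_(k < (mdeg m).+1)
      a^-1 * fcoef ((1 - fpsC a^-1 * f) ^+ k) m)
  else f.

Lemma fcoef0M f g : fcoef (f * g) 0%MM = fcoef f 0%MM * fcoef g 0%MM.
Proof.
rewrite (fps_agreeM (@fps_truncP _ _ 1 f) (@fps_truncP _ _ 1 g)) ?mdeg0 //.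
by rewrite rmorphM /= -!fps_truncP ?mdeg0.
Qed.

Lemma fps_mulVr : {in fps_unit, left_inverse 1 fps_inv *%R}.
Proof.
move=> f fU; rewrite mulrC; apply/fpsP => m.
have a0 : fcoef f 0%MM != 0 by [].
set a := fcoef f 0%MM in a0; pose u := 1 - fpsC a^-1 * f.
have u0 : fcoef u 0%MM = 0.
  by rewrite /u fcoefD fcoefN fcoefCM fcoef1 eqxx mulVf // subrr.
pose N := (mdeg m).+1; pose s := fpsC a^-1 * \sum_(k < N) u ^+ k.
rewrite (@fcoef_mul_eq _ _ _ _ s); last first.
  move=> k km; rewrite /s fcoefCM fcoef_sum mulr_sumr /fps_inv ifT //=.
  rewrite (big_ord_widen N (fun j => a^-1 * fcoef (u ^+ j) k)) //.
  rewrite big_mkcond; apply: eq_bigr => j _; case: ltnP => // kj.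
  by rewrite fcoef_expr_eq0 // mulr0.
have -> : f * s = 1 - u ^+ N.
  rewrite /s mulrA (mulrC f) (_ : fpsC _ * f = 1 - u); last first.
    by rewrite /u opprB addrC subrK.
  by rewrite -[in RHS](expr1n _ N) subrXX; congr (_ * _); apply: eq_bigr => j _;
    rewrite expr1n mul1r.
by rewrite fcoefD fcoefN fcoef_expr_eq0 // subr0.
Qed.

Lemma fps_unitP f g : g * f = 1 -> fps_unit f.
Proof.
move=> /(congr1 (fcoef^~ 0%MM)); rewrite fcoef0M fcoef1 eqxx => /eqP E.
by apply/negP => /eqP f0; move: E; rewrite f0 mulr0 eq_sym oner_eq0.
Qed.

Lemma fps_inv_out : {in [predC fps_unit], fps_inv =1 id}.
Proof. by move=> f fN; rewrite /fps_inv ifN. Qed.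

HB.instance Definition _ := GRing.ComNzRing_hasMulInverse.Build (fps n R)
  fps_mulVr fps_unitP fps_inv_out.

Lemma fps_unitE f : (f \is a GRing.unit) = (fcoef f 0%MM != 0).
Proof. by []. Qed.

End Unit.

Lemma sum_ord4 (V : nmodType) (F : 'I_4 -> V) :
  \sum_i F i = F 0 + F 1 + F 2 + F 3.
Proof.
rewrite !big_ord_recr big_ord0 /= add0r.
by do !congr (_ + _); congr F; apply: val_inj.
Qed.

Lemma sum_ord3 (V : nmodType) (F : 'I_3 -> V) : \sum_i F i = F 0 + F 1 + F 2.
Proof.
rewrite !big_ord_recr big_ord0 /= add0r.
by do !congr (_ + _); congr F; apply: val_inj.
Qed.

Lemma det2 (K : comNzRingType) (A : 'M[K]_2) :
  \det A = A 0 0 * A 1 1 - A 0 1 * A 1 0.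
Proof.
rewrite (expand_det_row _ 0) !big_ord_recr big_ord0 /= /cofactor.
rewrite !det_mx11 !mxE add0r.
pose B i j := A (inord i) (inord j).
have E i j : A i j = B i j by rewrite /B !inord_val.
by rewrite !E /= /bump /=; ring.
Qed.

Lemma det3 (K : comNzRingType) (A : 'M[K]_3) : \det A =
    A 0 0 * (A 1 1 * A 2 2 - A 1 2 * A 2 1)
  - A 0 1 * (A 1 0 * A 2 2 - A 1 2 * A 2 0)
  + A 0 2 * (A 1 0 * A 2 1 - A 1 1 * A 2 0).
Proof.
rewrite (expand_det_row _ 0) sum_ord3 /cofactor !det2 !mxE.
pose B i j := A (inord i) (inord j).
have E i j : A i j = B i j by rewrite /B !inord_val.
by rewrite !E /= /bump /=; ring.
Qed.

Lemma det4 (K : comNzRingType) (A : 'M[K]_4) : \det A =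
    let M (s t i j : 'I_4) := A s i * A t j - A s j * A t i in
    M 0 1 0 1 * M 2 3 2 3 - M 0 1 0 2 * M 2 3 1 3 + M 0 1 0 3 * M 2 3 1 2
  + M 0 1 1 2 * M 2 3 0 3 - M 0 1 1 3 * M 2 3 0 2 + M 0 1 2 3 * M 2 3 0 1.
Proof.
rewrite (expand_det_row _ 0) sum_ord4 /cofactor !det3 !mxE.
pose B i j := A (inord i) (inord j).
have E i j : A i j = B i j by rewrite /B !inord_val.
by rewrite !E /= /bump /=; ring.
Qed.

Section Poisson.
Variable R : realType.
Local Notation RR := (fps 4 R).
Implicit Types (h g k : RR).

(* The matrix of a bivector [pi] has entries [pi(dx_i, dx_j)]. *)
Definition pairing (P : 'M[RR]_4) (a b : 'rV[RR]_4) : RR :=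
  (a *m P *m b^T) 0 0.

(* The second condition is the coordinate expression of [[pi, pi] = 0], i.e. of
   the Jacobi identity for the bracket [{g, k} = pi(dg, dk)]. *)
Definition is_poisson (P : 'M[RR]_4) : Prop :=
  P^T = - P /\
  forall i j k : 'I_4,
    \sum_(l < 4) (P i l * fps_deriv l (P j k) + P j l * fps_deriv l (P k i)
                + P k l * fps_deriv l (P i j)) = 0.

Record poisson := MkPoisson {
  bivector :> 'M[RR]_4;
  bivector_poisson : is_poisson bivector }.

Definition formal_diffeo (phi : 4.-tuple RR) : Prop :=
  (forall i, fcoef (tnth phi i) 0%MM = 0) /\
  \matrix_(i < 4, j < 4) fcoef (tnth phi i) U_(j)%MM \in unitmx.

Definition jacobian (phi : 4.-tuple RR) : 'M[RR]_4 :=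
  \matrix_(i, j) fps_deriv j (tnth phi i).

(* The bivector [P'] such that [P'(d(g o phi), d(k o phi)) = P(dg, dk) o phi]
   for all [g] and [k], where [d(g o phi)] is the row [(dg o phi) * J], with
   [J] the Jacobian matrix of [phi]. *)
Definition pullback (phi : 4.-tuple RR) (P : 'M[RR]_4) : 'M[RR]_4 :=
  invmx (jacobian phi) *m map_mx (fun g => fps_comp g phi) P
    *m (invmx (jacobian phi))^T.

Definition formally_equivalent (P P' : poisson) : Prop :=
  exists2 phi, formal_diffeo phi & pullback phi P = P'.

Definition x1 : RR := fpsX 0.
Definition x2 : RR := fpsX 1.
Definition x3 : RR := fpsX 2.
Definition x4 : RR := fpsX 3.

Definition f1 : RR := x1 ^+ 2 - x2 ^+ 2 + x3 ^+ 2 - x4 ^+ 2.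
Definition f2 : RR := 2 * (x1 * x2 + x3 * x4).

(* A formal 4-form [h mu] is represented by its density [h]. *)
Definition volume_form h : Prop := 0 < fcoef h 0%MM.

(* The density of [a /\ b /\ c /\ d] with respect to [mu]. *)
Definition wedge4 (a b c d : 'rV[RR]_4) : RR :=
  \det (\matrix_(i < 4) tnth [tuple a; b; c; d] i).

Definition jacobian_bivector h : 'M[RR]_4 := \matrix_(i, j)
  (h^-1 * wedge4 (differential (fpsX i)) (differential (fpsX j))
            (differential f1) (differential f2)).

Lemma ord4P (P : 'I_4 -> Prop) : P 0 -> P 1 -> P 2 -> P 3 -> forall i, P i.
Proof.
move=> P0 P1 P2 P3 [[|[|[|[|//]]]] i4].
- by move: P0; congr P; apply: val_inj.
- by move: P1; congr P; apply: val_inj.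
- by move: P2; congr P; apply: val_inj.
- by move: P3; congr P; apply: val_inj.
Qed.

Lemma wedge4E (a b c d : 'rV[RR]_4) : wedge4 a b c d =
    let M (s t : 'rV[RR]_4) i j := s 0 i * t 0 j - s 0 j * t 0 i in
    M a b 0 1 * M c d 2 3 - M a b 0 2 * M c d 1 3 + M a b 0 3 * M c d 1 2
  + M a b 1 2 * M c d 0 3 - M a b 1 3 * M c d 0 2 + M a b 2 3 * M c d 0 1.
Proof. by rewrite /wedge4 det4 /= !mxE !(tnth_nth 0) /=. Qed.

Lemma deriv_x (i : 'I_4) : (fps_deriv i x1 = (i == 0)%:R) *
  (fps_deriv i x2 = (i == 1)%:R) * (fps_deriv i x3 = (i == 2)%:R) *
  (fps_deriv i x4 = (i == 3)%:R).
Proof. by rewrite !fps_derivX. Qed.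

Lemma differentialE g j : differential g 0 j = fps_deriv j g.
Proof. by rewrite mxE. Qed.

Lemma deriv_f1 (j : 'I_4) :
  fps_deriv j f1 = nth 0 [:: 2 * x1; - (2 * x2); 2 * x3; - (2 * x4)] j.
Proof.
rewrite /f1 !expr2 !(fps_derivD, fps_derivN, fps_derivM) !deriv_x.
by move: j; apply: ord4P => /=; ring.
Qed.

Lemma deriv_f2 (j : 'I_4) :
  fps_deriv j f2 = nth 0 [:: 2 * x2; 2 * x1; 2 * x4; 2 * x3] j.
Proof.
rewrite /f2 !(fps_derivD, fps_derivM, fps_deriv_nat) !deriv_x.
by move: j; apply: ord4P => /=; ring.
Qed.

Let omega (i j : 'I_4) : RR := wedge4 (differential (fpsX i))
  (differential (fpsX j)) (differential f1) (differential f2).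

Let tab (a b c d : RR) (i j : 'I_4) : RR := nth 0 (nth [::]
  [:: [:: 0; a; b; - c]; [:: - a; 0; c; b];
      [:: - b; - c; 0; d]; [:: c; - b; - d; 0]] i) j.

Let omegaE i j : omega i j = 4 * tab (x3 ^+ 2 + x4 ^+ 2) (x2 * x3 - x1 * x4)
  (x1 * x3 + x2 * x4) (x1 ^+ 2 + x2 ^+ 2) i j.
Proof.
rewrite /omega wedge4E /= !differentialE !fps_derivX !deriv_f1 !deriv_f2 /tab.
by move: i j; apply: ord4P; apply: ord4P => /=; ring.
Qed.

Let deriv_tab l a b c d i j : fps_deriv l (tab a b c d i j) =
  tab (fps_deriv l a) (fps_deriv l b) (fps_deriv l c) (fps_deriv l d) i j.
Proof.
by move: i j; apply: ord4P; apply: ord4P => /=;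
  first [exact: fps_deriv0 | by [] | exact: fps_derivN].
Qed.

Lemma jacobian_bivector_poisson h : is_poisson (jacobian_bivector h).
Proof.
have [a aE] : {a | a = x3 ^+ 2 + x4 ^+ 2} by eexists.
have [b bE] : {b | b = x2 * x3 - x1 * x4} by eexists.
have [c cE] : {c | c = x1 * x3 + x2 * x4} by eexists.
have [d dE] : {d | d = x1 ^+ 2 + x2 ^+ 2} by eexists.
have E i j : jacobian_bivector h i j = (4 * h^-1) * tab a b c d i j.
  by rewrite mxE aE bE cE dE -/(omega i j) omegaE; ring.
move: (4 * h^-1) E => u E.
have Da l : fps_deriv l a = nth 0 [:: 0; 0; 2 * x3; 2 * x4] l.
  rewrite aE !expr2 !(fps_derivD, fps_derivM) !deriv_x.
  by move: l; apply: ord4P => /=; ring.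
have Db l : fps_deriv l b = nth 0 [:: - x4; x3; x2; - x1] l.
  rewrite bE !(fps_derivD, fps_derivN, fps_derivM) !deriv_x.
  by move: l; apply: ord4P => /=; ring.
have Dc l : fps_deriv l c = nth 0 [:: x3; x4; x1; x2] l.
  rewrite cE !(fps_derivD, fps_derivM) !deriv_x.
  by move: l; apply: ord4P => /=; ring.
have Dd l : fps_deriv l d = nth 0 [:: 2 * x1; 2 * x2; 0; 0] l.
  rewrite dE !expr2 !(fps_derivD, fps_derivM) !deriv_x.
  by move: l; apply: ord4P => /=; ring.
split.
  apply/matrixP=> i j; rewrite [LHS]mxE [RHS]mxE !E /tab.
  by move: i j; apply: ord4P; apply: ord4P => /=; ring.
move=> i j k.
have D l s t : fps_deriv l (jacobian_bivector h s t) =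
    fps_deriv l u * tab a b c d s t +
    u * tab (fps_deriv l a) (fps_deriv l b) (fps_deriv l c) (fps_deriv l d) s t.
  by rewrite E fps_derivM deriv_tab.
under eq_bigr => l _ do rewrite !D !E Da Db Dc Dd.
rewrite sum_ord4 /tab /=.
move: (fps_deriv 0 u) (fps_deriv 1 u) (fps_deriv 2 u) (fps_deriv 3 u).
move: (x1) (x2) (x3) (x4) aE bE cE dE => y1 y2 y3 y4 aE bE cE dE u1 u2 u3 u4.
by move: i j k; apply: ord4P; apply: ord4P; apply: ord4P => /=;
  rewrite ?aE ?bE ?cE ?dE; ring.
Qed.
Definition poisson_of h : poisson :=
  MkPoisson (jacobian_bivector_poisson h).

(* For [nu = h mu], [poisson_of h] is the unique bivector [pi] such that
   [pi(dg, dk) nu = dg /\ dk /\ df1 /\ df2]. *)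
Lemma poisson_ofP h : volume_form h -> forall g k,
  pairing (poisson_of h) (differential g) (differential k) * h =
  wedge4 (differential g) (differential k) (differential f1) (differential f2).
Proof.
move=> h0 g k; have hU : h \is a GRing.unit by rewrite fps_unitE gt_eqF.
have E i j : poisson_of h i j = h^-1 * omega i j by rewrite mxE.
have -> : pairing (poisson_of h) (differential g) (differential k) =
    h^-1 * (\sum_j \sum_i fps_deriv i g * omega i j * fps_deriv j k).
  rewrite /pairing mxE mulr_sumr; apply: eq_bigr => j _.
  rewrite mxE [_^T _ _]mxE mulr_suml mulr_sumr; apply: eq_bigr => i _.
  by rewrite E !differentialE !mulrA (mulrC _ h^-1).
rewrite mulrAC mulVr // mul1r.
rewrite /omega; move: (differential f1) (differential f2) => c d.
under eq_bigr => j _ do under eq_bigr => i _ do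
  rewrite wedge4E /= !differentialE !fps_derivX.
by rewrite !sum_ord4 wedge4E /= !differentialE; ring.
Qed.

Lemma poisson_of_uniq h (P : 'M[RR]_4) : volume_form h ->
  (forall g k, pairing P (differential g) (differential k) * h =
     wedge4 (differential g) (differential k)
       (differential f1) (differential f2)) ->
  P = poisson_of h.
Proof.
move=> h0 PE; have hU : h \is a GRing.unit by rewrite fps_unitE gt_eqF.
have X (Q : 'M[RR]_4) i j :
    pairing Q (differential (fpsX i)) (differential (fpsX j)) = Q i j.
  have dX (s : 'I_4) : differential (fpsX s : RR) = delta_mx 0 s.
    by apply/rowP => t; rewrite differentialE fps_derivX mxE eqxx eq_sym.
  by rewrite /pairing !dX -rowE trmx_delta -colE !mxE.
apply/matrixP => i j; apply: (mulIr hU).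
by rewrite -[P i j]X -[poisson_of h i j]X PE poisson_ofP.
Qed.

Definition in_Rf1f2 (p : RR) : Prop :=
  exists q : fps 2 R, p = fps_comp q [tuple f1; f2].

Definition in_ideal_f1f2 (p : RR) : Prop :=
  exists a b : RR, [/\ in_Rf1f2 a, in_Rf1f2 b & p = a * f1 + b * f2].

End Poisson.

(* Main.v *)
(** The linear vector fields [A = (x3, x4, -x1, -x2)] and
    [B = (-x4, x3, x2, -x1)] commute, annihilate [f1] and [f2], and are
    divergence free.  Put [z1 = x1 + i x2] and [z2 = x3 + i x4].  In the
    coordinates [u = z1 + i z2], [v = z1 - i z2] and their conjugates both
    fields are diagonal, and a monomial killed by both is a product of powers of
    [uv = f1 + i f2] and of its conjugate.  Hence every [h] is [k + A a + B b]
    with [k] a series in [f1], [f2] and [A b = 0].  For [alpha = a / (k + B b)]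
    and [beta = b / k], the map [psi = exp (alpha A + beta B) x] preserves [f1]
    and [f2], and its Jacobian determinant is
    [(1 + A alpha) (1 + B beta) - A beta B alpha = h / k], because [A beta = 0].
    So [psi] pulls [k mu] back to [h mu], and its inverse is the required
    diffeomorphism. *)

Require Import Defs.
From mathcomp Require Import all_boot all_order all_algebra reals.
From HB Require Import structures.
From mathcomp Require Import boolp mpoly ring complex.

Set Implicit Arguments.
Unset Strict Implicit.
Unset Printing Implicit Defensive.

Import Order.TTheory GRing.Theory Num.Theory.
Local Open Scope ring_scope.

(** * Substitution of formal power series *)

Section Order.
Variables (n : nat) (R : comNzRingType).
Implicit Types (f g : fps n R).

(** This is membership in the [d]-th power of the ideal generated by the variables. *)
Definition fps_order_ge d f := forall m, (mdeg m < d)%N -> fcoef f m = 0.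

Lemma fps_order_geM d e f g :
  fps_order_ge d f -> fps_order_ge e g -> fps_order_ge (d + e) (f * g).
Proof.
move=> fd ge m mde; rewrite fcoefM big1 // => k km.
have [kd|kd] := ltnP (mdeg k) d; first by rewrite fd // mul0r.
rewrite ge ?mulr0 //; move: mde; rewrite -{1}(submK km) mdegD => mde.
by rewrite -(ltn_add2r (mdeg k)) (leq_trans mde) // addnC leq_add2l.
Qed.

Lemma fps_order_geX d f k : fps_order_ge d f -> fps_order_ge (d * k) (f ^+ k).
Proof.
move=> fd; elim: k => [|k IH]; first by rewrite muln0.
by rewrite exprS mulnS; apply: fps_order_geM.
Qed.

Lemma fps_order_ge_prod (I : Type) (r : seq I) (d : I -> nat)
    (F : I -> fps n R) :
    (forall i, fps_order_ge (d i) (F i)) ->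
  fps_order_ge (\sum_(i <- r) d i) (\prod_(i <- r) F i).
Proof.
move=> Fd; elim: r => [|i r IH]; first by rewrite !big_nil.
by rewrite !big_cons; apply: fps_order_geM.
Qed.

Lemma fps_agreeXn d f p k : fps_agree d f p -> fps_agree d (f ^+ k) (p ^+ k).
Proof.
move=> fp; elim: k => [|k IH]; first exact: fps_agreeC.
by rewrite !exprS; apply: fps_agreeM.
Qed.

Lemma fps_agree_prod d (I : Type) (r : seq I) (F : I -> fps n R) G :
    (forall i, fps_agree d (F i) (G i)) ->
  fps_agree d (\prod_(i <- r) F i) (\prod_(i <- r) G i).
Proof.
move=> FG; elim: r => [|i r IH]; first by rewrite !big_nil; exact: fps_agreeC.
by rewrite !big_cons; apply: fps_agreeM.
Qed.

Lemma fps_agree_sum d (I : Type) (r : seq I) (F : I -> fps n R) G :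
    (forall i, fps_agree d (F i) (G i)) ->
  fps_agree d (\sum_(i <- r) F i) (\sum_(i <- r) G i).
Proof.
move=> FG; elim: r => [|i r IH].
  by rewrite !big_nil => m _; rewrite mcoeff0.
by rewrite !big_cons; apply: fps_agreeD.
Qed.

End Order.

Lemma fpsX_no_const (R : comNzRingType) n (i : 'I_n) :
  fcoef (fpsX i : fps n R) 0%MM = 0.
Proof.
by rewrite /=; case: eqP => // /(congr1 (@mdeg n)); rewrite mdeg0 mdeg1.
Qed.

Section CompMpoly.
Variables (R : comNzRingType) (k n : nat).
Implicit Types (p : {mpoly R[k]}) (q : k.-tuple {mpoly R[n]}).

(** Reduces identities built from substitution and differentiation to the case of a single
    variable. *)
Lemma comp_mpoly_ind (P : {mpoly R[k]} -> Prop) :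
    P 1 -> (forall i, P 'X_i) -> (forall p p', P p -> P p' -> P (p * p')) ->
    (forall c p, P p -> P (c *: p)) ->
    (forall p p', P p -> P p' -> P (p + p')) ->
  forall p, P p.
Proof.
move=> P1 PX PM PZ PD; elim/mpolyind => [|c m p _ _ Pp].
  by rewrite -(scale0r 1); apply: PZ.
apply: (PD) => //; apply: PZ; rewrite mpolyXE_id.
by elim/big_ind: _ => // i _; elim: (m i) => // l; rewrite exprS; apply: PM.
Qed.

Lemma comp_mpolyA l p q (r : n.-tuple {mpoly R[l]}) :
  (p \mPo q) \mPo r = p \mPo [tuple tnth q i \mPo r | i < k].
Proof.
elim/comp_mpoly_ind: p => [|i|p p' Ep Ep'|c p Ep|p p' Ep Ep'].
- by rewrite !rmorph1.
- by rewrite !comp_mpolyXU -!tnth_nth tnth_mktuple.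
- by rewrite !rmorphM /= Ep Ep'.
- by rewrite !comp_mpolyZ Ep.
by rewrite !comp_mpolyD Ep Ep'.
Qed.

Lemma mderiv_comp j p q :
  (p \mPo q)^`M(j) = \sum_i (p^`M(i) \mPo q) * (tnth q i)^`M(j).
Proof.
elim/comp_mpoly_ind: p => [|i|p p' Ep Ep'|c p Ep|p p' Ep Ep'].
- rewrite rmorph1 -mpolyC1 mderivC big1 // => i _.
  by rewrite mderivC comp_mpoly0 mul0r.
- rewrite comp_mpolyXU -tnth_nth (bigD1 i) //= big1 ?addr0 => [|i' i'i].
    rewrite mderivX mnm1E eqxx scale1r (_ : U_(i) - U_(i) = 0)%MM.
      by rewrite mpolyX0 rmorph1 mul1r.
    by apply/mnmP => t; rewrite mnmBE subnn mnm0E.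
  by rewrite mderivX mnm1E eq_sym (negbTE i'i) scale0r comp_mpoly0 mul0r.
- rewrite rmorphM mderivM Ep Ep' mulr_suml mulr_sumr -big_split.
  apply: eq_bigr => i _; rewrite mderivM rmorphD !rmorphM /= mulrDl.
  by rewrite mulrAC mulrA.
- rewrite comp_mpolyZ mderivZ Ep scaler_sumr; apply: eq_bigr => i _.
  by rewrite mderivZ comp_mpolyZ scalerAl.
rewrite comp_mpolyD mderivD Ep Ep' -big_split.
by apply: eq_bigr => i _; rewrite mderivD comp_mpolyD mulrDl.
Qed.

End CompMpoly.

Definition fps_no_const (R : comNzRingType) (k n : nat)
    (phi : k.-tuple (fps n R)) :=
  forall i, fcoef (tnth phi i) 0%MM = 0.

Section Comp.
Variables (R : comNzRingType) (k n : nat).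
Implicit Types (g : fps k R) (phi : k.-tuple (fps n R)).

Lemma fps_order_ge1 (f : fps n R) : fcoef f 0%MM = 0 -> fps_order_ge 1 f.
Proof. by move=> f0 m; rewrite ltnS leqn0 mdeg_eq0 => /eqP->. Qed.

Lemma fps_order_ge_mnm phi (l : 'X_{1..k}) : fps_no_const phi ->
  fps_order_ge (mdeg l) (\prod_(i < k) tnth phi i ^+ l i).
Proof.
move=> phi0; rewrite mdegE; apply: fps_order_ge_prod => i.
by rewrite -[X in fps_order_ge X]mul1n; apply/fps_order_geX/fps_order_ge1/phi0.
Qed.

(** As [phi] has no constant term, monomials of degree at least [d] in [g] do not reach degrees
    below [d]. Identities for [fps_comp] can therefore be checked on polynomials. *)
Lemma fps_agree_comp d g p phi q : fps_no_const phi ->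
    fps_agree d g p -> (forall i, fps_agree d (tnth phi i) (tnth q i)) ->
  fps_agree d (fps_comp g phi) (p \mPo q).
Proof.
move=> phi0 gp phiq m md.
have prodE (l : 'X_{1..k}) : fcoef (\prod_(i < k) tnth phi i ^+ l i) m =
    (\prod_(i < k) tnth q i ^+ l i)@_m.
  apply: (fps_agree_prod (d := d)) => // i; exact: fps_agreeXn.
pose pT := fps_trunc (mdeg m).+1 g.
transitivity (pT \mPo q)@_m.
  rewrite /pT /fps_trunc (raddf_sum (comp_mpoly q)) (raddf_sum (mcoeff m)).
  apply: eq_bigr => l _.
  by rewrite /= comp_mpolyZ comp_mpolyX mcoeffZ prodE.
(* The truncation and [p] differ only in monomials of degree above [mdeg m], and these contribute
   nothing to the coefficient at [m]. *)
apply/eqP; rewrite eq_sym -subr_eq0 -mcoeffB -comp_mpolyB comp_mpolyE.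
rewrite raddf_sum /= big1_seq // => l /andP[_ lp].
rewrite mcoeffZ -prodE (fps_order_ge_mnm phi0) ?mulr0 //.
rewrite ltnNge; apply/negP => lm; move: lp; rewrite mcoeff_msupp mcoeffB.
by rewrite -fps_truncP ?ltnS // -gp ?subrr ?eqxx // (leq_ltn_trans lm).
Qed.

Lemma fps_comp_agree_trunc d g phi : fps_no_const phi ->
  fps_agree d (fps_comp g phi)
    (fps_trunc d g \mPo [tuple fps_trunc d (tnth phi i) | i < k]).
Proof.
move=> phi0; apply: fps_agree_comp => // [|i]; first exact: fps_truncP.
by rewrite tnth_mktuple; apply: fps_truncP.
Qed.

Lemma fcoef_comp0 g phi : fps_no_const phi ->
  fcoef (fps_comp g phi) 0%MM = fcoef g 0%MM.
Proof.
move=> phi0; rewrite (@fps_agree_comp 1 _ (fcoef g 0%MM)%:MP _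
  [tuple fps_trunc 1 (tnth phi i) | i < k]) ?mdeg0 //.
- by rewrite comp_mpolyC mcoeffC eqxx mulr1.
- move=> m; rewrite ltnS leqn0 mdeg_eq0 => /eqP->.
  by rewrite mcoeffC eqxx mulr1.
by move=> i; rewrite tnth_mktuple; apply: fps_truncP.
Qed.

Lemma fps_compD phi g g' :
  fps_comp (g + g') phi = fps_comp g phi + fps_comp g' phi.
Proof.
apply/fpsP => m /=; rewrite -big_split.
by apply: eq_bigr => l _; rewrite mulrDl.
Qed.

Lemma fps_compC phi c : fps_no_const phi -> fps_comp (fpsC c) phi = fpsC c.
Proof.
move=> phi0; apply: fps_agree_eq => d; exists c%:MP; last exact: fps_agreeC.
rewrite -(comp_mpolyC c [tuple fps_trunc d (tnth phi i) | i < k]).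
apply: fps_agree_comp => // [|i]; first exact: fps_agreeC.
by rewrite tnth_mktuple; apply: fps_truncP.
Qed.

Lemma fps_compM phi g g' : fps_no_const phi ->
  fps_comp (g * g') phi = fps_comp g phi * fps_comp g' phi.
Proof.
move=> phi0; apply: fps_agree_eq => d.
set q := [tuple fps_trunc d (tnth phi i) | i < k].
exists ((fps_trunc d g * fps_trunc d g') \mPo q); last first.
  by rewrite rmorphM; apply: fps_agreeM; apply: fps_comp_agree_trunc.
apply: fps_agree_comp => // [|i].
  by apply: fps_agreeM; apply: fps_truncP.
by rewrite tnth_mktuple; apply: fps_truncP.
Qed.

Lemma fps_compX phi i : fps_no_const phi -> fps_comp (fpsX i) phi = tnth phi i.
Proof.
move=> phi0; apply: fps_agree_eq => d.
set q := [tuple fps_trunc d (tnth phi i) | i < k].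
exists ('X_i \mPo q).
  apply: fps_agree_comp => // [|j]; first exact: fps_agreeX.
  by rewrite tnth_mktuple; apply: fps_truncP.
by rewrite comp_mpolyXU -tnth_nth tnth_mktuple; apply: fps_truncP.
Qed.

Lemma fps_deriv_comp j phi g : fps_no_const phi ->
  fps_deriv j (fps_comp g phi) =
    \sum_i fps_comp (fps_deriv i g) phi * fps_deriv j (tnth phi i).
Proof.
move=> phi0; apply: fps_agree_eq => d.
set q := [tuple fps_trunc d.+1 (tnth phi i) | i < k].
exists (fps_trunc d.+1 g \mPo q)^`M(j).
  exact/fps_agree_deriv/fps_comp_agree_trunc.
rewrite mderiv_comp; apply: fps_agree_sum => i; apply: fps_agreeM.
  apply: fps_agree_comp => // [|l]; first exact/fps_agree_deriv/fps_truncP.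
  apply: (@fps_agreeW _ _ d.+1) => //.
  by rewrite tnth_mktuple; apply: fps_truncP.
by rewrite tnth_mktuple; apply/fps_agree_deriv/fps_truncP.
Qed.

End Comp.

Section CompMorph.
Variables (R : comNzRingType) (k n : nat) (phi : k.-tuple (fps n R)).
Hypothesis phi0 : fps_no_const phi.

(** The proof about [phi] is an argument so that a ring morphism structure can be attached to the
    substitution. *)
Definition fps_subst of fps_no_const phi := fun g : fps k R => fps_comp g phi.

Lemma fps_subst_is_additive : additive (fps_subst phi0).
Proof.
move=> g g'; apply/eqP; rewrite eq_sym subr_eq /fps_subst.
by rewrite -fps_compD subrK.
Qed.

Lemma fps_subst_is_multiplicative : multiplicative (fps_subst phi0).
Proof. by split=> [g g'|]; rewrite /fps_subst ?fps_compM ?(fps_compC 1). Qed.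

HB.instance Definition _ :=
  GRing.isAdditive.Build _ _ (fps_subst phi0) fps_subst_is_additive.
HB.instance Definition _ :=
  GRing.isMultiplicative.Build _ _ (fps_subst phi0) fps_subst_is_multiplicative.

End CompMorph.

Lemma fps_compA (R : comNzRingType) (k l n : nat) (g : fps k R)
    (phi : k.-tuple (fps l R)) (psi : l.-tuple (fps n R)) :
    fps_no_const phi -> fps_no_const psi ->
  fps_comp (fps_comp g phi) psi =
    fps_comp g [tuple fps_comp (tnth phi i) psi | i < k].
Proof.
move=> phi0 psi0; apply: fps_agree_eq => d.
set p := [tuple fps_trunc d (tnth phi i) | i < k].
set q := [tuple fps_trunc d (tnth psi i) | i < l].
have psiq i : fps_agree d (tnth psi i) (tnth q i).
  by rewrite tnth_mktuple; apply: fps_truncP.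
exists ((fps_trunc d g \mPo p) \mPo q).
  by apply: fps_agree_comp => //; apply: fps_comp_agree_trunc.
rewrite comp_mpolyA; apply: fps_agree_comp => [i||i].
- by rewrite tnth_mktuple fcoef_comp0.
- exact: fps_truncP.
rewrite !tnth_mktuple; apply: fps_agree_comp => //; exact: fps_truncP.
Qed.

Lemma fps_comp_id (R : comNzRingType) (n : nat) (g : fps n R) :
  fps_comp g [tuple fpsX i | i < n] = g.
Proof.
apply: fps_agree_eq => d; exists (fps_trunc d g); last exact: fps_truncP.
rewrite -[X in fps_agree _ _ X]comp_mpoly_id; apply: fps_agree_comp.
- by move=> i; rewrite tnth_mktuple fpsX_no_const.
- exact: fps_truncP.
by move=> i; rewrite !tnth_mktuple; apply: fps_agreeX.
Qed.

(* The iterates of [phi |-> W(phi) x] stabilise degree by degree, since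
   multiplication by [x] gains one degree of agreement. *)
Lemma fps_fixpoint (R : comNzRingType) (n : nat) (W : 'M[fps n R]_n) :
  exists2 phi : n.-tuple (fps n R), fps_no_const phi &
    forall i, tnth phi i = \sum_j fps_comp (W i j) phi * fpsX j.
Proof.
pose F (phi : n.-tuple (fps n R)) :=
  [tuple \sum_j fps_comp (W i j) phi * fpsX j | i < n].
pose eqd d (phi psi : n.-tuple (fps n R)) :=
  forall i m, (mdeg m < d)%N -> fcoef (tnth phi i) m = fcoef (tnth psi i) m.
have F0 phi : fps_no_const (F phi).
  move=> i; rewrite tnth_mktuple fcoef_sum big1 // => j _.
  rewrite fcoefM big1 // => l l0.
  rewrite (_ : (0 - l = 0)%MM) ?fpsX_no_const ?mulr0 //.
  by apply/mnmP => t; rewrite mnmBE mnm0E.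
have Feq d phi psi : fps_no_const phi -> fps_no_const psi ->
    eqd d phi psi -> eqd d.+1 (F phi) (F psi).
  move=> phi0 psi0 E i m md; rewrite !tnth_mktuple.
  apply/eqP; rewrite -subr_eq0 -fcoefN -fcoefD -sumrB fcoef_sum big1 // => j _.
  rewrite -mulrBl; apply: (@fps_order_geM _ _ d 1); last by rewrite addn1.
    move=> l ld; rewrite fcoefD fcoefN.
    pose q := [tuple fps_trunc d (tnth phi i) | i < n].
    rewrite !(@fps_agree_comp _ _ _ d _ (fps_trunc d (W i j)) _ q) ?subrr //.
    - exact: fps_truncP.
    - by move=> t u ud; rewrite -E // tnth_mktuple -fps_truncP.
    - exact: fps_truncP.
    by move=> t; rewrite tnth_mktuple; apply: fps_truncP.
  exact/fps_order_ge1/fpsX_no_const.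
pose it d := iter d F [tuple 0 | _ < n].
have it0 d : fps_no_const (it d).
  by case: d => [i|d]; [rewrite tnth_mktuple | apply: F0].
have itE d e : (d <= e)%N -> eqd d (it d) (it e).
  elim: d e => [|d IH] [|e] // de; apply: Feq => //; exact: IH.
(* Coefficients of degree [d] are read off the iterate [d + 1], from which on they no longer
   change. *)
pose phi := [tuple Fps (fun m => fcoef (tnth (it (mdeg m).+1) i) m) | i < n].
have phiE d : eqd d phi (it d).
  by move=> i m md; rewrite tnth_mktuple /=; exact: (itE _ _ md _ _ (ltnSn _)).
have phi0 : fps_no_const phi by move=> i; rewrite tnth_mktuple; apply: it0.
exists phi => // i; apply/fpsP => m.
rewrite (phiE (mdeg m).+1) //.
transitivity (fcoef (tnth (F phi) i) m); last by rewrite tnth_mktuple.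
by apply: (Feq (mdeg m)) => // t l lm; rewrite (phiE (mdeg m)).
Qed.

(** * Decomposition along the fibre fields *)

Lemma prod_ord4 (V : comNzRingType) (F : 'I_4 -> V) :
  \prod_i F i = F 0 * F 1 * F 2 * F 3.
Proof.
rewrite !big_ord_recr big_ord0 /= mul1r.
by do !congr (_ * _); congr F; apply: val_inj.
Qed.

Lemma prod_ord2 (V : comNzRingType) (F : 'I_2 -> V) : \prod_i F i = F 0 * F 1.
Proof.
rewrite !big_ord_recr big_ord0 /= mul1r.
by do !congr (_ * _); congr F; apply: val_inj.
Qed.

Lemma ord2P (P : 'I_2 -> Prop) : P 0 -> P 1 -> forall i, P i.
Proof.
move=> P0 P1 [[|[|//]] i2].
- by move: P0; congr P; apply: val_inj.
- by move: P1; congr P; apply: val_inj.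
Qed.

(** * Derivations along formal vector fields *)

Section Lie.
Variables (R : comNzRingType) (n : nat).
Implicit Types (X : 'I_n -> fps n R) (g : fps n R).

Definition fps_lie X g := \sum_i X i * fps_deriv i g.

Lemma fps_lieD X g g' : fps_lie X (g + g') = fps_lie X g + fps_lie X g'.
Proof.
by rewrite -big_split; apply: eq_bigr => i _; rewrite fps_derivD mulrDr.
Qed.

Lemma fps_lieM X g g' :
  fps_lie X (g * g') = fps_lie X g * g' + g * fps_lie X g'.
Proof.
rewrite mulr_suml mulr_sumr -big_split; apply: eq_bigr => i _.
by rewrite fps_derivM mulrDr mulrA; congr (_ + _); rewrite mulrCA.
Qed.

Lemma fps_lie_comp X (k : nat) (phi : k.-tuple (fps n R)) (g : fps k R) :
    fps_no_const phi ->
  fps_lie X (fps_comp g phi) =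
    \sum_l fps_comp (fps_deriv l g) phi * fps_lie X (tnth phi l).
Proof.
move=> phi0; rewrite /fps_lie.
under eq_bigr => i _ do rewrite fps_deriv_comp // mulr_sumr.
rewrite exchange_big /=; apply: eq_bigr => l _; rewrite mulr_sumr.
by apply: eq_bigr => i _; rewrite mulrCA.
Qed.

(** The second hypothesis says that [X] and [Y] are [phi]-related; by the chain rule, substitution
    then intertwines the two derivations. *)
Lemma fps_lie_subst X (Y : 'I_n -> fps n R) (phi : n.-tuple (fps n R)) g :
    fps_no_const phi ->
    (forall l, fps_lie X (tnth phi l) = fps_comp (Y l) phi) ->
  fps_lie X (fps_comp g phi) = fps_comp (fps_lie Y g) phi.
Proof.
move=> phi0 XY; rewrite fps_lie_comp // -[RHS]/(fps_subst phi0 _) rmorph_sum.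
by apply: eq_bigr => l _; rewrite rmorphM /= mulrC XY.
Qed.

Lemma mnm_subK (m : 'X_{1..n}) i : (0 < m i)%N -> (m - U_(i) + U_(i))%MM = m.
Proof.
move=> mi; apply/mnmP => j; rewrite mnmDE mnmBE mnm1E.
by case: eqP => [<-|_]; rewrite ?subnK // subn0 addn0.
Qed.

Lemma fcoefXM i g m :
  fcoef (fpsX i * g) m = if m i == 0%N then 0 else fcoef g (m - U_(i))%MM.
Proof.
have [mi0|mi] := posnP (m i).
  rewrite fcoefM big1 // => k /mnm_lepP/(_ i); rewrite mi0 leqn0 => /eqP ki.
  rewrite [fcoef (fpsX i) _]/=; case: eqP => [E|_]; last by rewrite mul0r.
  by move: ki; rewrite E mnm1E eqxx.
pose d := (mdeg m).+1.
rewrite (fps_agreeM (@fps_agreeX _ _ d i) (@fps_truncP _ _ d g)) //.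
rewrite (mulrC 'X_i) -{1}(mnm_subK mi) addmC mcoeffMX -fps_truncP //.
by rewrite /d ltnS mdegB.
Qed.

(** Euler operators are diagonal on monomials, which is why [diagA] and [diagB] below act by
    weights. *)
Lemma fps_euler i g m : fcoef (fpsX i * fps_deriv i g) m = (m i)%:R * fcoef g m.
Proof.
rewrite fcoefXM; have [->|] := posnP (m i); first by rewrite mul0r.
move=> mi; rewrite /= mnm_subK // mnmBE mnm1E eqxx subn1 prednK //.
by rewrite mulr_natl.
Qed.

End Lie.

(** * Weight decomposition for the diagonalised fields *)

Section Diag.
Variables (K : numFieldType) (ii : K).
Hypothesis ii2 : ii * ii = -1.

(** Eigenvalues of [A] and, below, of [B] on [u], [v] and their conjugates, in this order. *)
Let wA (l : 'I_4) : K := nth 0 [:: - ii; ii; ii; - ii] l.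
Let wB (l : 'I_4) : K := nth 0 [:: 1; - 1; 1; - 1] l.

Definition weightA (m : 'X_{1..4}) : K :=
  ii * ((m 1)%:R + (m 2)%:R - (m 0)%:R - (m 3)%:R).
Definition weightB (m : 'X_{1..4}) : K :=
  (m 0)%:R - (m 1)%:R + (m 2)%:R - (m 3)%:R.

Definition diagA (l : 'I_4) : fps 4 K := fpsC (wA l) * fpsX l.
Definition diagB (l : 'I_4) : fps 4 K := fpsC (wB l) * fpsX l.

Lemma diagAE G m : fcoef (fps_lie diagA G) m = weightA m * fcoef G m.
Proof.
rewrite fcoef_sum; under eq_bigr => l _ do rewrite -mulrA fcoefCM fps_euler.
by rewrite sum_ord4 /wA /weightA /=; ring.
Qed.

Lemma diagBE G m : fcoef (fps_lie diagB G) m = weightB m * fcoef G m.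
Proof.
rewrite fcoef_sum; under eq_bigr => l _ do rewrite -mulrA fcoefCM fps_euler.
by rewrite sum_ord4 /wB /weightB /=; ring.
Qed.

(** The hypotheses read [m 1 + m 2 = m 0 + m 3] and [m 0 + m 2 = m 1 + m 3]. Their sum and
    difference give twice the two claims, and the characteristic is zero. *)
Lemma weights0 m : weightA m = 0 -> weightB m = 0 -> m 0 = m 1 /\ m 2 = m 3.
Proof.
move=> /eqP; rewrite mulf_eq0; case/orP => [/eqP i0|/eqP A0 B0].
  by move: ii2; rewrite i0 mul0r => /eqP; rewrite eq_sym oppr_eq0 oner_eq0.
have n2 : (2 : K) != 0 by rewrite pnatr_eq0.
split; apply/eqP; rewrite -(eqr_nat K) -subr_eq0 -(mulrI_eq0 _ (mulfI n2)).
  by apply/eqP; rewrite -[RHS](subrr 0) -{1}B0 -A0 /weightB; ring.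
by apply/eqP; rewrite -[RHS](addr0 0) -{1}B0 -A0 /weightB; ring.
Qed.

(** Exponent of the [l 0]-th power of [uv] times the [l 1]-th power of its conjugate. *)
Definition paired_mnm (l : 'X_{1..2}) : 'X_{1..4} :=
  [multinom nth 0%N [:: l 0%R; l 0%R; l 1%R; l 1%R] i | i < 4].

Lemma fcoef_paired (l : 'X_{1..2}) m :
  fcoef (\prod_(i < 2) tnth [tuple fpsX 0 * fpsX 1; fpsX 2 * fpsX 3] i ^+ l i) m
  = (m == paired_mnm l)%:R :> K.
Proof.
pose q : 2.-tuple {mpoly K[4]} := [tuple 'X_0 * 'X_1; 'X_2 * 'X_3].
rewrite (@fps_agree_prod _ _ (mdeg m).+1 _ _ _ (fun i => tnth q i ^+ l i)) //.
  rewrite eq_sym -mcoeffX.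
  congr (_@_m); rewrite mpolyXE_id prod_ord4 prod_ord2 !mnmE !(tnth_nth 0) /=.
  by rewrite !exprMn !mulrA.
move=> i; apply: fps_agreeXn; rewrite !(tnth_nth 0); move: i.
by apply: ord2P => /=; apply: fps_agreeM; apply: fps_agreeX.
Qed.

Lemma weightA_paired l : weightA (paired_mnm l) = 0.
Proof. by rewrite /weightA !mnmE /=; ring. Qed.

Lemma weightB_paired l : weightB (paired_mnm l) = 0.
Proof. by rewrite /weightB !mnmE /=; ring. Qed.

(** Both fields act on monomials by scalars. A monomial of nonzero [A]-weight is put into [a], one
    of zero [A]-weight and nonzero [B]-weight into [b], and the remaining ones are paired. As [b] is
    supported on [A]-weight zero, [A] kills it. *)
Lemma diag_decomposition (G : fps 4 K) : exists (Q : fps 2 K) (a b : fps 4 K),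
  [/\ G = fps_comp Q [tuple fpsX 0 * fpsX 1; fpsX 2 * fpsX 3] +
          fps_lie diagA a + fps_lie diagB b,
      fps_lie diagA b = 0, fcoef a 0%MM = 0 & fcoef b 0%MM = 0].
Proof.
(* As [x / 0 = 0], the quotients below vanish where the weight does. *)
exists (Fps (fun l => fcoef G (paired_mnm l))).
exists (Fps (fun m => fcoef G m / weightA m)).
exists (Fps (fun m => if weightA m == 0 then fcoef G m / weightB m else 0)).
have w0 : (weightA 0%MM = 0) * (weightB 0%MM = 0).
  by rewrite /weightA /weightB !mnm0E; split; ring.
split; last 2 first.
- by rewrite /= w0 invr0 mulr0.
- by rewrite /= !w0 eqxx invr0 mulr0.
- apply/fpsP => m; rewrite !fcoefD diagAE diagBE /=.
  under eq_bigr => l _ do rewrite fcoef_paired.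
  have [A0|A0] := eqVneq (weightA m) 0; last first.
    rewrite mulr0 addr0 big1 ?add0r => [|l _].
      by rewrite mulrCA mulfV ?mulr1.
    case: eqP => [E|_]; last by rewrite mulr0.
    by have := weightA_paired l; rewrite -E => /eqP; rewrite (negbTE A0).
  rewrite A0 mul0r addr0; have [B0|B0] := eqVneq (weightB m) 0; last first.
    rewrite big1 ?add0r => [|l _]; first by rewrite mulrCA mulfV ?mulr1.
    case: eqP => [E|_]; last by rewrite mulr0.
    by have := weightB_paired l; rewrite -E => /eqP; rewrite (negbTE B0).
  rewrite B0 mul0r addr0; have [m01 m23] := weights0 A0 B0.
  pose l0 : 'X_{1..2} := [multinom nth 0%N [:: m 0%R; m 2%R] i | i < 2].
  have ml0 : m = paired_mnm l0.
    by apply/mnmP; apply: ord4P; rewrite !mnmE.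
  (* This bound places [l0] in the finite range of summation that defines [fps_comp]. *)
  have l0m : (mdeg l0 < (mdeg m).+1)%N.
    rewrite ltnS !mdegE sum_ord4 !big_ord_recr big_ord0 /= !mnmE /= add0n.
    set a := m 0; set b := m 1; set c := m 2; set e := m 3.
    by apply: (@leq_trans (a + b + c)); rewrite ?leq_addr // leq_add2r leq_addr.
  rewrite (bigD1 (BMultinom l0m)) //= -ml0 eqxx mulr1 big1 ?addr0 // => l ll0.
  case: eqP => [E|_]; last by rewrite mulr0.
  case/eqP: ll0; apply: val_inj; apply/mnmP => /=.
  have El : paired_mnm l = paired_mnm l0 by rewrite -E.
  apply: ord2P.
    by move/mnmP/(_ 0): El; rewrite !mnmE.
  by move/mnmP/(_ 2): El; rewrite !mnmE.
- apply/fpsP => m; rewrite diagAE /=.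
  by case: eqP => [->|_]; rewrite ?mul0r ?mulr0.
Qed.

End Diag.

Section LinearFields.
Variable R : comNzRingType.

(** The fields and the quadratic forms are set up over any ring because they serve over both the
    real and the complex numbers; over the reals [quad1] and [quad2] are [f1] and [f2]. *)
Definition fieldA (i : 'I_4) : fps 4 R :=
  nth 0 [:: fpsX 2; fpsX 3; - fpsX 0; - fpsX 1] i.
Definition fieldB (i : 'I_4) : fps 4 R :=
  nth 0 [:: - fpsX 3; fpsX 2; fpsX 1; - fpsX 0] i.
Definition quad1 : fps 4 R :=
  fpsX 0 ^+ 2 - fpsX 1 ^+ 2 + fpsX 2 ^+ 2 - fpsX 3 ^+ 2.
Definition quad2 : fps 4 R := 2 * (fpsX 0 * fpsX 1 + fpsX 2 * fpsX 3).

End LinearFields.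

Section Constants.
Variables (R : comNzRingType) (n : nat).

Lemma fps_deriv_fpsC c i : fps_deriv i (fpsC c : fps n R) = 0.
Proof.
apply/fpsP => m /=; case: eqP => [/mnmP/(_ i)|_]; last by rewrite mul0rn.
by rewrite mnmDE mnm0E mnm1E eqxx addn1.
Qed.

Lemma fpsC_is_additive : additive (@fpsC n R).
Proof. by move=> a b; apply/fpsP => m /=; case: eqP; rewrite ?subr0. Qed.

Lemma fpsC_is_multiplicative : multiplicative (@fpsC n R).
Proof.
split=> // a b; apply/fpsP => m; rewrite fcoefCM /=.
by case: eqP; rewrite ?mulr0.
Qed.

HB.instance Definition _ :=
  GRing.isAdditive.Build R (fps n R) (@fpsC n R) fpsC_is_additive.
HB.instance Definition _ :=
  GRing.isMultiplicative.Build R (fps n R) (@fpsC n R) fpsC_is_multiplicative.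

End Constants.

(** * Return from the diagonal coordinates when the field contains a square root of -1 *)

Section ComplexDecomposition.
#[local] Arguments fcoef : simpl never.
Variables (K : numFieldType) (ii : K).
Hypothesis ii2 : ii * ii = -1.
Local Notation I := (fpsC ii : fps 4 K).
Local Notation x i := (fpsX i : fps 4 K).

Lemma fpsC_ii2 : I * I = -1.
Proof. by rewrite -rmorphM ii2 rmorphN1. Qed.

(** The coordinates [u], [v] and their conjugates, ordered like the weights of [diagA] and
    [diagB]. *)
Definition isotropic : 4.-tuple (fps 4 K) :=
  [tuple x 0 + I * x 1 + I * x 2 - x 3; x 0 + I * x 1 - I * x 2 + x 3;
         x 0 - I * x 1 - I * x 2 - x 3; x 0 - I * x 1 + I * x 2 + x 3].

(** The factor [- q * I] is the inverse of [4 * I]. *)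
Definition isotropic_inv : 4.-tuple (fps 4 K) :=
  let q : fps 4 K := fpsC 4^-1 in
  [tuple q * (x 0 + x 1 + x 2 + x 3); - q * I * (x 0 + x 1 - x 2 - x 3);
         - q * I * (x 0 - x 1 - x 2 + x 3); - q * (x 0 - x 1 + x 2 - x 3)].

Lemma isotropic_no_const : fps_no_const isotropic.
Proof.
apply: ord4P; rewrite (tnth_nth 0) /=;
  rewrite !(fcoefD, fcoefN, fcoefCM, fpsX_no_const);
  ring.
Qed.

Lemma isotropic_inv_no_const : fps_no_const isotropic_inv.
Proof.
apply: ord4P; rewrite (tnth_nth 0) /= !fcoef0M;
  rewrite !(fcoefD, fcoefN, fpsX_no_const);
  ring.
Qed.

Lemma fpsC4 : fpsC 4^-1 * 4 = 1 :> fps 4 K.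
Proof.
by rewrite -(rmorph_nat (@fpsC 4 K) 4) -rmorphM mulVf ?rmorph1 ?pnatr_eq0.
Qed.

Lemma isotropicK g : fps_comp (fps_comp g isotropic_inv) isotropic = g.
Proof.
rewrite (fps_compA _ isotropic_inv_no_const isotropic_no_const).
rewrite -[RHS]fps_comp_id; congr fps_comp; apply: eq_from_tnth.
have n0 := isotropic_no_const.
(* Substitution is replaced by an abstract ring morphism, which can be pushed through the formulas
   without unfolding. *)
have [phi phiE] : exists phi : {rmorphism fps 4 K -> fps 4 K},
    forall g', fps_comp g' isotropic = phi g' by exists (fps_subst n0).
have phiX i : phi (fpsX i) = tnth isotropic i by rewrite -phiE fps_compX.
have phiC c : phi (fpsC c) = fpsC c by rewrite -phiE fps_compC.
have [I2 C4] := (fpsC_ii2, fpsC4).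
apply: ord4P; rewrite !tnth_mktuple phiE (tnth_nth 0) /=;
  rewrite !(rmorphM, rmorphD, rmorphB, rmorphN) /= !phiC !phiX;
  rewrite !(tnth_nth 0) /=;
  move: C4 I2;
  move: I (fpsC 4^-1) (x 0) (x 1) (x 2) (x 3) => i q y0 y1 y2 y3 q4 i2.
- by rewrite -[RHS]mul1r -q4; ring.
- transitivity (- (i * i) * (q * 4) * y1); first by ring.
  by rewrite i2 q4; ring.
- transitivity (- (i * i) * (q * 4) * y2); first by ring.
  by rewrite i2 q4; ring.
by rewrite -[RHS]mul1r -q4; ring.
Qed.

Lemma isotropic_lieA l :
  fps_lie (@fieldA K) (tnth isotropic l) = fps_comp (diagA ii l) isotropic.
Proof.
rewrite /diagA fps_compM ?fps_compX ?fps_compC; try exact: isotropic_no_const.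
rewrite /fps_lie sum_ord4 /fieldA; have I2 := fpsC_ii2; move: l.
apply: ord4P; rewrite !(tnth_nth 0) /= ?rmorphN /=;
  rewrite !(fps_derivD, fps_derivN, fps_derivM, fps_derivX, fps_deriv_fpsC) /=;
  move: I2; move: I (x 0) (x 1) (x 2) (x 3) => i y0 y1 y2 y3 i2;
  ring: i2.
Qed.

Lemma isotropic_lieB l :
  fps_lie (@fieldB K) (tnth isotropic l) = fps_comp (diagB K l) isotropic.
Proof.
rewrite /diagB fps_compM ?fps_compX ?fps_compC; try exact: isotropic_no_const.
rewrite /fps_lie sum_ord4 /fieldB; move: l.
apply: ord4P; rewrite !(tnth_nth 0) /= ?rmorphN ?rmorph1 /=;
  rewrite !(fps_derivD, fps_derivN, fps_derivM, fps_derivX, fps_deriv_fpsC) /=;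
  move: I (x 0) (x 1) (x 2) (x 3) => i y0 y1 y2 y3; by ring.
Qed.

Definition quad_pair : 2.-tuple (fps 4 K) := [tuple quad1 K; quad2 K].

Lemma quad_no_const : fps_no_const quad_pair.
Proof.
apply: ord2P; rewrite (tnth_nth 0) /= /quad1 /quad2.
  by rewrite !(fcoefD, fcoefN, expr2, fcoef0M, fpsX_no_const); ring.
by rewrite fcoef0M !(fcoefD, fcoef0M, fpsX_no_const); ring.
Qed.

(** The isotropic coordinates are eigenvectors of both fields, so [diag_decomposition] can be pulled
    back along them. *)
Lemma complex_decomposition (g : fps 4 K) :
  exists (Q : fps 2 K) (a b : fps 4 K),
  [/\ g = fps_comp Q quad_pair + fps_lie (@fieldA K) a + fps_lie (@fieldB K) b,
      fps_lie (@fieldA K) b = 0, fcoef a 0%MM = 0 & fcoef b 0%MM = 0].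
Proof.
have n0 := isotropic_no_const.
have [Q [a [b [gE Ab a0 b0]]]] :=
  diag_decomposition ii2 (fps_comp g isotropic_inv).
have EA f := fps_lie_subst f n0 isotropic_lieA.
have EB f := fps_lie_subst f n0 isotropic_lieB.
pose J : fps 2 K := fpsC ii.
(* The paired products are [quad1 + I * quad2] and [quad1 - I * quad2]; [lin] turns a series in them
   into a series in [quad1] and [quad2]. *)
pose lin : 2.-tuple (fps 2 K) :=
  [tuple fpsX 0 + J * fpsX 1; fpsX 0 - J * fpsX 1].
have lin0 : fps_no_const lin.
  apply: ord2P; rewrite (tnth_nth 0) /=;
    rewrite !(fcoefD, fcoefN, fcoefCM, fpsX_no_const);
    ring.
exists (fps_comp Q lin), (fps_comp a isotropic), (fps_comp b isotropic).
split; rewrite ?fcoef_comp0 //; last first.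
  by rewrite EA Ab -[LHS]/(fps_subst n0 0) rmorph0.
rewrite EA EB -[LHS](isotropicK g) gE !fps_compD; congr (_ + _ + _).
rewrite (fps_compA _ lin0 quad_no_const).
rewrite fps_compA //; last first.
  by apply: ord2P; rewrite (tnth_nth 0) /= fcoef0M fpsX_no_const mul0r.
congr fps_comp; apply: eq_from_tnth.
have n1 := quad_no_const.
have c0 : fps_comp (fpsX 0 : fps 2 K) quad_pair = quad1 K by apply: fps_compX.
have c1 : fps_comp (fpsX 1 : fps 2 K) quad_pair = quad2 K by apply: fps_compX.
have cJ : fps_comp J quad_pair = I by apply: fps_compC.
have cM f f' : fps_comp (f - J * f') quad_pair =
    fps_comp f quad_pair - I * fps_comp f' quad_pair.
  by rewrite -cJ -fps_compM // -[LHS]/(fps_subst n1 _) rmorphB.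
apply: ord2P; rewrite !tnth_mktuple !(tnth_nth 0) /=;
  rewrite fps_compM ?fps_compX // !(tnth_nth 0) /=;
  rewrite ?cM ?fps_compD ?fps_compM // ?cJ c0 c1 /quad1 /quad2;
  have := fpsC_ii2;
  move: I (x 0) (x 1) (x 2) (x 3) => i y0 y1 y2 y3 i2; ring: i2.
Qed.

End ComplexDecomposition.

(** * Descent from complex to real coefficients *)

Section RealDecomposition.
Variable R : rcfType.
Local Notation C := (R[i]).
Local Notation toC := (real_complex R).
Local Notation Re := (@complex.Re R).

Let ReD (z w : C) : Re (z + w) = Re z + Re w.
Proof. by case: z w => a b [c d]. Qed.

Let ReM (a : R) (z : C) : Re (toC a * z) = a * Re z.
Proof. by case: z => b c /=; rewrite mul0r subr0. Qed.

Let Re_sum (J : Type) (r : seq J) (P : pred J) (F : J -> C) :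
  Re (\sum_(i <- r | P i) F i) = \sum_(i <- r | P i) Re (F i).
Proof. by apply: (big_morph Re ReD). Qed.

Definition fps_toC n (f : fps n R) : fps n C := Fps (fun m => toC (fcoef f m)).
Definition fps_Re n (f : fps n C) : fps n R := Fps (fun m => Re (fcoef f m)).

Lemma fps_toCK n (f : fps n R) : fps_Re (fps_toC f) = f.
Proof. by apply/fpsP. Qed.

Lemma fps_ReD n (f g : fps n C) : fps_Re (f + g) = fps_Re f + fps_Re g.
Proof. by apply/fpsP => m /=; rewrite ReD. Qed.

Lemma fps_ReM n (f : fps n R) (g : fps n C) :
  fps_Re (fps_toC f * g) = f * fps_Re g.
Proof.
by apply/fpsP => m; rewrite /= Re_sum; apply: eq_bigr => k _; rewrite ReM.
Qed.

Lemma fps_Re_sum n (J : Type) (r : seq J) (F : J -> fps n C) :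
  fps_Re (\sum_(i <- r) F i) = \sum_(i <- r) fps_Re (F i).
Proof. by apply: (big_morph (@fps_Re n) (@fps_ReD n)); apply/fpsP. Qed.

Lemma fps_Re_deriv n i (f : fps n C) :
  fps_Re (fps_deriv i f) = fps_deriv i (fps_Re f).
Proof.
apply/fpsP => m /=; elim: (m i) => // l IH.
by rewrite mulrS ReD IH -mulrS.
Qed.

Lemma fps_Re_lie n (X : 'I_n -> fps n R) (f : fps n C) :
  fps_Re (fps_lie (fun i => fps_toC (X i)) f) = fps_lie X (fps_Re f).
Proof.
by rewrite fps_Re_sum; apply: eq_bigr => i _; rewrite fps_ReM fps_Re_deriv.
Qed.

Lemma fps_toC_is_additive n : additive (@fps_toC n).
Proof. by move=> f g; apply/fpsP => m /=; rewrite rmorphB. Qed.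

Lemma fps_toC_is_multiplicative n : multiplicative (@fps_toC n).
Proof.
split=> [f g|]; apply/fpsP => m /=.
  by rewrite rmorph_sum; apply: eq_bigr => k _; rewrite rmorphM.
by case: eqP.
Qed.

HB.instance Definition _ n :=
  GRing.isAdditive.Build (fps n R) (fps n C)
    (@fps_toC n) (@fps_toC_is_additive n).
HB.instance Definition _ n := GRing.isMultiplicative.Build
  (fps n R) (fps n C) (@fps_toC n) (@fps_toC_is_multiplicative n).

Lemma fps_toCX n (i : 'I_n) : fps_toC (fpsX i) = fpsX i.
Proof. by apply/fpsP => m /=; case: eqP. Qed.

Lemma fps_Re_comp k n (Q : fps k C) (phi : k.-tuple (fps n R)) :
  fps_Re (fps_comp Q [tuple fps_toC (tnth phi i) | i < k]) =
    fps_comp (fps_Re Q) phi.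
Proof.
apply/fpsP => m; rewrite /= Re_sum; apply: eq_bigr => l _.
rewrite (_ : \prod_(i < k) _ = fps_toC (\prod_(i < k) tnth phi i ^+ l i)).
  by rewrite mulrC ReM mulrC.
by rewrite rmorph_prod; apply: eq_bigr => i _; rewrite tnth_mktuple rmorphXn.
Qed.

(** The fields and both quadratic forms have real coefficients, so the coefficientwise real part of
    a complex decomposition is a real one. *)
Lemma real_decomposition (g : fps 4 R) : exists (Q : fps 2 R) (a b : fps 4 R),
  [/\ g = fps_comp Q [tuple quad1 R; quad2 R] +
          fps_lie (@fieldA R) a + fps_lie (@fieldB R) b,
      fps_lie (@fieldA R) b = 0, fcoef a 0%MM = 0 & fcoef b 0%MM = 0].
Proof.
have i2 : Complex 0 1 * Complex 0 1 = -1 :> C.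
  by rewrite -expr2 sqr_i.
have [Q [a [b [gE Ab a0 b0]]]] := complex_decomposition i2 (fps_toC g).
have AE : @fieldA C = fun i => fps_toC (fieldA R i).
  by apply/funext; apply: ord4P; rewrite /= ?rmorphN /= fps_toCX.
have BE : @fieldB C = fun i => fps_toC (fieldB R i).
  by apply/funext; apply: ord4P; rewrite /= ?rmorphN /= fps_toCX.
have qE : quad_pair C =
    [tuple fps_toC (tnth [tuple quad1 R; quad2 R] i) | i < 2].
  apply: eq_from_tnth; apply: ord2P; rewrite tnth_mktuple !(tnth_nth 0) /=.
    by rewrite /quad1 !(rmorphD, rmorphN, rmorphXn) /= !fps_toCX.
  rewrite /quad2 (rmorphM (@fps_toC 4)) (rmorph_nat (@fps_toC 4) 2) rmorphD.
  by rewrite !rmorphM /= !fps_toCX.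
exists (fps_Re Q), (fps_Re a), (fps_Re b); split.
- by rewrite -[LHS]fps_toCK gE !fps_ReD AE BE !fps_Re_lie qE fps_Re_comp.
- by rewrite -fps_Re_lie -AE Ab; apply/fpsP.
- by rewrite /= a0.
by rewrite /= b0.
Qed.

End RealDecomposition.

(** * The flow of the fibre fields *)

Lemma fps_deriv_eq0 (R : numFieldType) n (f : fps n R) :
  (forall i, fps_deriv i f = 0) -> f = fpsC (fcoef f 0%MM).
Proof.
move=> df; apply/fpsP => m /=; case: eqP => [->//|/eqP m0].
have [i mi] : exists i, (0 < m i)%N.
  apply/existsP; apply: contraNT m0; rewrite negb_exists => /forallP m0.
  by apply/eqP/mnmP => i; have := m0 i; rewrite mnm0E -eqn0Ngt => /eqP.
have := congr1 (fcoef^~ (m - U_(i))%MM) (df i).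
by rewrite /= mnm_subK // => /eqP; rewrite mulrn_eq0 /= => /eqP.
Qed.

(* Cosine and sine of [a] for [eps = -1], the hyperbolic ones for [eps = 1]. *)
Lemma fps_trig (R : numFieldType) n (eps : R) (a : fps n R) :
    fcoef a 0%MM = 0 ->
  exists C S : fps n R,
    [/\ forall j, fps_deriv j C = fpsC eps * S * fps_deriv j a,
        forall j, fps_deriv j S = C * fps_deriv j a &
        C * C - fpsC eps * (S * S) = 1].
Proof.
move=> a0.
(* The Taylor coefficients of both functions: even indices serve the cosine, odd ones the sine. *)
pose t (k : nat) : R := eps ^+ k./2 / k`!%:R.
have tS k : t k.+1 *+ k.+1 = (if odd k then eps else 1) * t k.
  have fE : (k.+1`!%:R : R)^-1 *+ k.+1 = k`!%:R^-1.
    rewrite factS natrM invfM -[LHS]mulr_natl mulrA mulfV ?mul1r //.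
    by rewrite pnatr_eq0.
  rewrite /t -mulrnAr fE mulrA; congr (_ * _).
  rewrite [k.+1./2]uphalf_half exprD.
  by case: (odd k); rewrite ?expr1 ?expr0.
pose c1 : fps 1 R := Fps (fun m => if odd (m 0) then 0 else t (m 0)).
pose s1 : fps 1 R := Fps (fun m => if odd (m 0) then t (m 0) else 0).
have dm (m : 'X_{1..1}) : (m + U_(0%R))%MM 0 = (m 0).+1.
  by rewrite mnmDE mnm1E eqxx addn1.
have dc1 : fps_deriv 0 c1 = fpsC eps * s1.
  apply/fpsP => m; rewrite fcoefCM /= dm /=; have := tS (m 0).
  by case: (odd (m 0)) => /= E; rewrite ?mul0rn ?mulr0.
have ds1 : fps_deriv 0 s1 = c1.
  apply/fpsP => m; rewrite /= dm /=; have := tS (m 0).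
  by case: (odd (m 0)) => /= E; rewrite ?mul0rn // E mul1r.
pose phi := [tuple a].
have phi0 : fps_no_const phi by move=> i; rewrite ord1 (tnth_nth 0).
have dcomp j g : fps_deriv j (fps_comp g phi) =
    fps_comp (fps_deriv 0 g) phi * fps_deriv j a.
  by rewrite fps_deriv_comp // big_ord1 (tnth_nth 0).
pose C := fps_comp c1 phi; pose S := fps_comp s1 phi.
have dC j : fps_deriv j C = fpsC eps * S * fps_deriv j a.
  by rewrite dcomp dc1 fps_compM // fps_compC.
have dS j : fps_deriv j S = C * fps_deriv j a by rewrite dcomp ds1.
exists C, S; split => //.
(* All partial derivatives of this expression cancel, so it equals its constant term. *)
have -> : C * C - fpsC eps * (S * S) =
    fpsC (fcoef (C * C - fpsC eps * (S * S)) 0%MM).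
  apply: fps_deriv_eq0 => i.
  by rewrite !(fps_derivD, fps_derivN, fps_derivM, fps_deriv_fpsC) dC dS; ring.
rewrite fcoefD fcoefN !fcoef0M !fcoef_comp0 //= mnm0E /= /t expr0 fact0 divr1.
by rewrite !mulr0 subr0 mulr1.
Qed.

Section Flow.
Variable R : comNzRingType.

(* The matrix of [exp (alpha A + beta B)], where [c], [s] are the cosine and
   sine of [alpha], and [c'], [s'] the hyperbolic ones of [beta]. *)
Definition flow_mx (c s c' s' : R) : 'M[R]_4 := \matrix_(i, j) nth 0 (nth [::]
  [:: [:: c' * c; s' * s; c' * s; - (s' * c)];
      [:: - (s' * s); c' * c; s' * c; c' * s];
      [:: - (c' * s); s' * c; c' * c; s' * s];
      [:: - (s' * c); - (c' * s); - (s' * s); c' * c]] i) j.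

Lemma det_flow_mx c s c' s' : c * c + s * s = 1 -> c' * c' - s' * s' = 1 ->
  \det (flow_mx c s c' s') = 1.
Proof.
move=> cs cs'; rewrite det4 /= !mxE /=.
transitivity ((c * c + s * s) ^+ 2 * (c' * c' - s' * s') ^+ 2); first by ring.
by rewrite cs cs' !expr1n mulr1.
Qed.

(** Replacing [alpha], [beta] by their opposites inverts the exponential; it changes the sign of the
    sines only. *)
Lemma flow_mxK c s c' s' : c * c + s * s = 1 -> c' * c' - s' * s' = 1 ->
  flow_mx c s c' s' *m flow_mx c (- s) c' (- s') = 1%:M.
Proof.
move=> cs cs'.
have E : (c * c + s * s) * (c' * c' - s' * s') = 1 by rewrite cs cs' mulr1.
apply/matrixP; apply: ord4P; apply: ord4P;
  rewrite !mxE sum_ord4 !mxE /= ?mulr1n ?mulr0n -?E; ring.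
Qed.

(** Sylvester's identity [det (1 + U V) = det (1 + V U)], with the two-by-two determinant on the
    right written out. *)
Lemma det_rank2_update (y y' a b : 'I_4 -> R) :
  \det (\matrix_(i, j) ((i == j)%:R + y i * a j + y' i * b j)) =
    (1 + \sum_i y i * a i) * (1 + \sum_i y' i * b i)
    - (\sum_i y i * b i) * (\sum_i y' i * a i).
Proof. rewrite det4 /= !mxE !sum_ord4 /=; ring. Qed.

End Flow.

Lemma map_flow_mx (R S : comNzRingType) (f : {rmorphism R -> S}) c s c' s' :
  map_mx f (flow_mx c s c' s') = flow_mx (f c) (f s) (f c') (f s').
Proof.
apply/matrixP => i j; rewrite [LHS]mxE /flow_mx ![in RHS]mxE [X in f X]mxE.
by move: i j; apply: ord4P; apply: ord4P; rewrite /= ?rmorphN rmorphM.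
Qed.

Section LieCommute.
Variables (R : comNzRingType) (n : nat).
Implicit Types (X Y : 'I_n -> fps n R) (g : fps n R).

Lemma fps_deriv_comm i j g :
  fps_deriv i (fps_deriv j g) = fps_deriv j (fps_deriv i g).
Proof.
apply: fps_agree_eq => d; exists (fps_trunc d.+2 g)^`M(j)^`M(i).
  by do 2!apply: fps_agree_deriv; apply: fps_truncP.
by rewrite mderiv_comm; do 2!apply: fps_agree_deriv; apply: fps_truncP.
Qed.

Lemma fps_lie0 X : fps_lie X 0 = 0.
Proof. by rewrite /fps_lie big1 // => i _; rewrite fps_deriv0 mulr0. Qed.

(** The second-order terms agree by symmetry of second derivatives, and the hypothesis, that the
    bracket of [X] and [Y] vanishes, matches the first-order ones. *)
Lemma fps_lie_commute X Y g : (forall j, fps_lie X (Y j) = fps_lie Y (X j)) ->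
  fps_lie X (fps_lie Y g) = fps_lie Y (fps_lie X g).
Proof.
have E Z Z' : fps_lie Z (fps_lie Z' g) =
    \sum_j fps_lie Z (Z' j) * fps_deriv j g +
    \sum_j \sum_i Z' j * (Z i * fps_deriv i (fps_deriv j g)).
  rewrite -big_split [fps_lie Z' g]/fps_lie.
  rewrite (big_morph _ (fps_lieD Z) (fps_lie0 Z)).
  by apply: eq_bigr => j _; rewrite fps_lieM [X in _ + _ * X]/fps_lie mulr_sumr.
move=> XY; rewrite !E; congr (_ + _).
  by apply: eq_bigr => j _; rewrite XY.
rewrite exchange_big; apply: eq_bigr => j _; apply: eq_bigr => i _.
by rewrite mulrCA fps_deriv_comm.
Qed.

End LieCommute.

Section FibreFields.
Variable R : numFieldType.
Implicit Types (g : fps 4 R).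

Lemma fieldA_no_const i : fcoef (fieldA R i) 0%MM = 0.
Proof.
move: i; apply: ord4P; rewrite /fieldA [nth _ _ _]/=;
  by rewrite ?fcoefN fpsX_no_const ?oppr0.
Qed.

Lemma fieldB_no_const i : fcoef (fieldB R i) 0%MM = 0.
Proof.
move: i; apply: ord4P; rewrite /fieldB [nth _ _ _]/=;
  by rewrite ?fcoefN fpsX_no_const ?oppr0.
Qed.

Lemma fcoef_lie0 (X : 'I_4 -> fps 4 R) g :
  (forall i, fcoef (X i) 0%MM = 0) -> fcoef (fps_lie X g) 0%MM = 0.
Proof.
by move=> X0; rewrite fcoef_sum big1 // => i _; rewrite fcoef0M X0 mul0r.
Qed.

Lemma fieldAB_commute g :
  fps_lie (@fieldA R) (fps_lie (@fieldB R) g) =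
  fps_lie (@fieldB R) (fps_lie (@fieldA R) g).
Proof.
apply: fps_lie_commute => j; rewrite /fps_lie !sum_ord4 /fieldA /fieldB.
by move: j; apply: ord4P; rewrite /= !(fps_derivN, fps_derivX) /=; ring.
Qed.

Lemma deriv_quad1 j : fps_deriv j (quad1 R) =
  nth 0 [:: 2 * fpsX 0; - (2 * fpsX 1); 2 * fpsX 2; - (2 * fpsX 3)] j.
Proof.
rewrite /quad1 !expr2 !(fps_derivD, fps_derivN, fps_derivM, fps_derivX).
by move: j; apply: ord4P => /=; ring.
Qed.

Lemma deriv_quad2 j : fps_deriv j (quad2 R) =
  nth 0 [:: 2 * fpsX 1; 2 * fpsX 0; 2 * fpsX 3; 2 * fpsX 2] j.
Proof.
rewrite /quad2 !(fps_derivD, fps_derivM, fps_derivX, fps_deriv_nat).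
by move: j; apply: ord4P => /=; ring.
Qed.

Lemma fps_lie_fibre (X : 'I_4 -> fps 4 R) (Q : fps 2 R) :
    fps_lie X (quad1 R) = 0 -> fps_lie X (quad2 R) = 0 ->
  fps_lie X (fps_comp Q (quad_pair R)) = 0.
Proof.
move=> X1 X2; rewrite (fps_lie_comp _ _ (@quad_no_const R)) big1 // => i _.
by move: i; apply: ord2P; rewrite (tnth_nth 0) /= ?X1 ?X2 mulr0.
Qed.

Lemma fieldA_fibre (Q : fps 2 R) :
  fps_lie (@fieldA R) (fps_comp Q (quad_pair R)) = 0.
Proof.
apply: fps_lie_fibre; rewrite /fps_lie sum_ord4 !(deriv_quad1, deriv_quad2);
  rewrite /fieldA /=; ring.
Qed.

Lemma fieldB_fibre (Q : fps 2 R) :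
  fps_lie (@fieldB R) (fps_comp Q (quad_pair R)) = 0.
Proof.
apply: fps_lie_fibre; rewrite /fps_lie sum_ord4 !(deriv_quad1, deriv_quad2);
  rewrite /fieldB /=; ring.
Qed.

(** The Leibniz rule for [(g / u) * u], where [u] is constant along [X]. *)
Lemma fps_lieV (X : 'I_4 -> fps 4 R) g u : u \is a GRing.unit ->
  fps_lie X u = 0 -> fps_lie X (g / u) = fps_lie X g / u.
Proof.
move=> uU Xu; apply: (mulIr uU); rewrite mulrVK // -[in RHS](mulrVK uU g).
by rewrite [RHS]fps_lieM Xu mulr0 addr0.
Qed.

End FibreFields.

Section ConstantTerm.
Variables (n : nat) (R : fieldType).

(** Evaluation at the origin, named so that it can be a ring morphism and commute with
    determinants. *)
Definition fps_const (f : fps n R) : R := fcoef f 0%MM.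

Lemma fps_const_is_additive : additive fps_const.
Proof. by []. Qed.

Lemma fps_const_is_multiplicative : multiplicative fps_const.
Proof. by split=> [f g|]; rewrite /fps_const ?fcoef0M // fcoef1 eqxx. Qed.

HB.instance Definition _ :=
  GRing.isAdditive.Build (fps n R) R fps_const fps_const_is_additive.
HB.instance Definition _ :=
  GRing.isMultiplicative.Build (fps n R) R
    fps_const fps_const_is_multiplicative.

End ConstantTerm.

Lemma formal_diffeo_jacobian (R : realType) (phi : 4.-tuple (fps 4 R)) :
  fps_no_const phi -> jacobian phi \in unitmx -> formal_diffeo phi.
Proof.
move=> phi0 JU; split => //.
rewrite (_ : \matrix_(i, j) _ = map_mx (@fps_const 4 R) (jacobian phi)).
  move: JU; rewrite !unitmxE det_map_mx; exact: rmorph_unit.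
apply/matrixP => i j; rewrite !mxE /fps_const /= mnm0E mulr1n.
by congr fcoef; apply/mnmP => l; rewrite mnmDE mnm0E.
Qed.

Section Flow.
Variable R : numFieldType.
Implicit Types (a b g : fps 4 R).

(** The flow matrix multiplies both forms by [(c * c + s * s) * (c' * c' - s' * s')], identically in
    all variables, and this factor is 1. *)
Lemma flow_quad (c s c' s' : fps 4 R) (y z : 'I_4 -> fps 4 R) :
    c * c + s * s = 1 -> c' * c' - s' * s' = 1 ->
    (forall i, z i = \sum_j flow_mx c s c' s' i j * y j) ->
  z 0 ^+ 2 - z 1 ^+ 2 + z 2 ^+ 2 - z 3 ^+ 2 =
    y 0 ^+ 2 - y 1 ^+ 2 + y 2 ^+ 2 - y 3 ^+ 2 /\
  2 * (z 0 * z 1 + z 2 * z 3) = 2 * (y 0 * y 1 + y 2 * y 3).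
Proof.
move=> cs cs' zE.
have E : (c * c + s * s) * (c' * c' - s' * s') = 1 by rewrite cs cs' mulr1.
rewrite !zE !sum_ord4 !mxE /=; split; rewrite -[RHS]mul1r -E; ring.
Qed.

(* [J] is the Jacobian matrix of [exp (a A + b B) x], and [phi] the inverse of
   that map. *)
Lemma fibre_flow a b : fcoef a 0%MM = 0 -> fcoef b 0%MM = 0 ->
  exists phi : 4.-tuple (fps 4 R),
    [/\ fps_no_const phi,
        fps_comp (quad1 R) phi = quad1 R, fps_comp (quad2 R) phi = quad2 R &
        exists2 J : 'M[fps 4 R]_4,
          \det J = (1 + fps_lie (@fieldA R) a) * (1 + fps_lie (@fieldB R) b)
                   - fps_lie (@fieldA R) b * fps_lie (@fieldB R) a &
          map_mx (fun g => fps_comp g phi) J *m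
            (\matrix_(i, j) fps_deriv j (tnth phi i)) = 1%:M].
Proof.
move=> a0 b0.
have [c [s [dc ds]]] := @fps_trig R 4 (-1) a a0.
rewrite rmorphN1 mulN1r opprK => cs.
have [c' [s' [dc' ds']]] := @fps_trig R 4 1 b b0; rewrite rmorph1 mul1r => cs'.
move: dc dc'; rewrite rmorphN1 rmorph1 => dc dc'.
(* With [F] the flow matrix, the inverse of [x |-> F(a, b) x] solves
   [phi = F(- a(phi), - b(phi)) x], an equation in fixed-point form. *)
have [phi phi0 phiE] := fps_fixpoint (flow_mx c (- s) c' (- s')).
have [T TE] : exists T : {rmorphism fps 4 R -> fps 4 R},
    forall g, fps_comp g phi = T g by exists (fps_subst phi0).
have TX i : T (fpsX i) = tnth phi i by rewrite -TE fps_compX.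
have Tcs : T c * T c + T s * T s = 1 by rewrite -!rmorphM -rmorphD cs rmorph1.
have Tcs' : T c' * T c' - T s' * T s' = 1.
  by rewrite -!rmorphM -rmorphB cs' rmorph1.
have phiF i : tnth phi i =
    \sum_j flow_mx (T c) (- T s) (T c') (- T s') i j * fpsX j.
  rewrite phiE; apply: eq_bigr => j _; congr (_ * _).
  by rewrite -!(rmorphN T) -map_flow_mx [RHS]mxE -TE.
have [||q1 q2] :=
  flow_quad (c := T c) (s := - T s) (c' := T c') (s' := - T s') _ _ phiF.
- by rewrite mulrNN.
- by rewrite mulrNN.
exists phi; split => //.
- by rewrite TE /quad1 !(rmorphD, rmorphN, rmorphXn) /= !TX q1.
- by rewrite TE /quad2 (rmorphM T) (rmorph_nat T 2) rmorphD !rmorphM /= !TX q2.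
pose psi i := \sum_j flow_mx c s c' s' i j * fpsX j.
exists (\matrix_(i, j) fps_deriv j (psi i)).
  (* The exponential commutes with [A] and [B], so differentiating [exp (a A + b B) x] gives the
     flow matrix, of determinant 1, times the identity plus [A(x) da + B(x) db]. *)
  pose N : 'M[fps 4 R]_4 := \matrix_(i, j)
    ((i == j)%:R + fieldA R i * fps_deriv j a + fieldB R i * fps_deriv j b).
  rewrite (_ : \matrix_(i, j) _ = flow_mx c s c' s' *m N).
    by rewrite det_mulmx det_flow_mx // mul1r det_rank2_update /fps_lie; ring.
  apply/matrixP => i j; rewrite [LHS]mxE [RHS]mxE /psi !sum_ord4.
  rewrite [N 0 j]mxE [N 1 j]mxE [N 2 j]mxE [N 3 j]mxE /fieldA /fieldB.
  rewrite !(fps_derivD, fps_derivM, fps_derivX).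
  move: i; apply: ord4P;
    rewrite !mxE /= !(fps_derivN, fps_derivM) dc ds dc' ds';
    rewrite !(eq_sym j);
    move: (fpsX 0 : fps 4 R) (fpsX 1 : fps 4 R) => y0 y1;
    move: (fpsX 2 : fps 4 R) (fpsX 3 : fps 4 R) => y2 y3; ring.
have psiK i : T (psi i) = fpsX i.
  rewrite rmorph_sum; under eq_bigr => j _ do rewrite rmorphM TX phiF mulr_sumr.
  rewrite exchange_big /=.
  transitivity (\sum_l (1%:M : 'M[fps 4 R]_4) i l * fpsX l).
    apply: eq_bigr => l _.
    rewrite -(@flow_mxK _ (T c) (T s) (T c') (T s')) // -map_flow_mx mxE.
    rewrite mulr_suml.
    by apply: eq_bigr => j _; rewrite [map_mx _ _ _ _]mxE mulrA.
  rewrite (bigD1 i) //= big1 ?addr0 ?mxE ?eqxx ?mul1r // => l li.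
  by rewrite mxE eq_sym (negbTE li) mul0r.
(* The matrix identity is the chain rule for [psi(phi) = x]. *)
apply/matrixP => i j.
transitivity (fps_deriv j (T (psi i))); last first.
  by rewrite psiK fps_derivX mxE eq_sym.
rewrite -TE fps_deriv_comp // mxE.
by apply: eq_bigr => l _; rewrite !mxE.
Qed.

End Flow.

(** * Pull-back of the Poisson structures *)

Lemma congruence_mxK (R : comUnitRingType) n (J P : 'M[R]_n) : J \in unitmx ->
  invmx J *m (J *m P *m J^T) *m (invmx J)^T = P.
Proof.
by move=> JU; rewrite trmx_inv mulmxA mulKmx // mulmxK // unitmx_tr.
Qed.

Section Pullback.
Variable R : realType.
Implicit Types (h k g : fps 4 R) (phi : 4.-tuple (fps 4 R)).

Lemma wedge4_mulmx (a b c d : 'rV[fps 4 R]_4) (J : 'M[fps 4 R]_4) :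
  wedge4 (a *m J) (b *m J) (c *m J) (d *m J) = wedge4 a b c d * \det J.
Proof.
rewrite /wedge4 -det_mulmx; congr (\det _); apply/row_matrixP => i.
by rewrite row_mul !rowK; move: i; apply: ord4P; rewrite !(tnth_nth 0).
Qed.

Lemma map_wedge4 (f : {rmorphism fps 4 R -> fps 4 R})
    (a b c d : 'rV[fps 4 R]_4) :
  f (wedge4 a b c d) =
    wedge4 (map_mx f a) (map_mx f b) (map_mx f c) (map_mx f d).
Proof.
rewrite /wedge4 -det_map_mx; congr (\det _); apply/row_matrixP => i.
by rewrite -map_row !rowK; move: i; apply: ord4P; rewrite !(tnth_nth 0).
Qed.

Lemma differential_comp g phi : fps_no_const phi ->
  differential (fps_comp g phi) =
    map_mx (fun g => fps_comp g phi) (differential g) *m jacobian phi.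
Proof.
move=> phi0; apply/rowP => j; rewrite !mxE fps_deriv_comp //.
by apply: eq_bigr => i _; rewrite !mxE.
Qed.

(** Under [phi] the 4-form [dg /\ dk /\ df1 /\ df2] acquires the factor [\det (jacobian phi)], while
    [f1] and [f2] stay fixed. Hence the density [h] becomes [h(phi)] times this determinant. *)
Lemma pullback_poisson_of h k phi : volume_form h -> volume_form k ->
    fps_no_const phi ->
    fps_comp (f1 R) phi = f1 R -> fps_comp (f2 R) phi = f2 R ->
    fps_comp h phi * \det (jacobian phi) = k ->
  pullback phi (poisson_of h) = poisson_of k.
Proof.
move=> h0 k0 phi0 F1 F2 hJ; set J := jacobian phi.
have kU : k \is a GRing.unit by rewrite fps_unitE gt_eqF.
have hU : h \is a GRing.unit by rewrite fps_unitE gt_eqF.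
have JU : J \in unitmx.
  by move: kU; rewrite -hJ unitrM; case/andP.
have [T TE] : exists T : {rmorphism fps 4 R -> fps 4 R},
    (fun g => fps_comp g phi) = T by exists (fps_subst phi0).
suff PE : map_mx T (poisson_of h) = J *m poisson_of k *m J^T.
  by rewrite /pullback TE PE; apply: congruence_mxK.
(* On the right, entry [i j] is the bracket of two components of [phi]; multiplied by [k], it is a
   4-form density. *)
apply/matrixP => i j; apply: (mulIr kU).
have rowJ l : row l J = differential (tnth phi l).
  by apply/rowP => t; rewrite !mxE.
have -> : (J *m poisson_of k *m J^T) i j =
    pairing (poisson_of k)
      (differential (tnth phi i)) (differential (tnth phi j)).
  rewrite /pairing -!rowJ -row_mul !mxE; apply: eq_bigr => l _.
  by congr (_ * _); rewrite !mxE.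
rewrite poisson_ofP //.
have dphi l : differential (tnth phi l) =
    map_mx T (differential (fpsX l)) *m J.
  by rewrite -TE -differential_comp // fps_compX.
have df1 : differential (f1 R) = map_mx T (differential (f1 R)) *m J.
  by rewrite -TE -differential_comp // F1.
have df2 : differential (f2 R) = map_mx T (differential (f2 R)) *m J.
  by rewrite -TE -differential_comp // F2.
rewrite !dphi df1 df2 wedge4_mulmx -map_wedge4 [(map_mx T _) _ _]mxE.
rewrite [X in T X]mxE rmorphM -mulrA.
rewrite -hJ -[fps_comp h phi]/((fun g => fps_comp g phi) h) TE mulrCA !mulrA.
by rewrite -[_ * T h]mulrA -(rmorphM T) mulVr // rmorph1 mulr1.
Qed.

End Pullback.

Section Ideal.
Variable R : realType.

Lemma f1f2_no_const : fps_no_const [tuple f1 R; f2 R].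
Proof. exact: (@quad_no_const R). Qed.

Lemma in_ideal_const0 (p : fps 4 R) : in_ideal_f1f2 p -> fcoef p 0%MM = 0.
Proof.
move=> [a [b [_ _ ->]]]; have n0 := f1f2_no_const.
have e1 : fcoef (f1 R) 0%MM = 0 := n0 0.
have e2 : fcoef (f2 R) 0%MM = 0 := n0 1.
by rewrite fcoefD (fcoef0M a) (fcoef0M b) e1 e2 !mulr0 addr0.
Qed.

Lemma Rf1f2_sub_const (Q : fps 2 R) :
  in_ideal_f1f2 (fps_comp Q [tuple f1 R; f2 R] - fpsC (fcoef Q 0%MM)).
Proof.
have n0 := f1f2_no_const.
(* Monomials containing the first variable go to [Qa], pure powers of the second to [Qb], so that
   none is counted twice. *)
pose Qa : fps 2 R := Fps (fun m => fcoef Q (m + U_(0%R))%MM).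
pose Qb : fps 2 R :=
  Fps (fun m => if m 0 == 0%N then fcoef Q (m + U_(1%R))%MM else 0).
exists (fps_comp Qa [tuple f1 R; f2 R]), (fps_comp Qb [tuple f1 R; f2 R]).
split; [by exists Qa | by exists Qb |].
have QE : Q = fpsC (fcoef Q 0%MM) + Qa * fpsX 0 + Qb * fpsX 1.
  apply/fpsP => m; rewrite !fcoefD ![_ * fpsX _]mulrC !fcoefXM /=.
  rewrite mnmBE mnm1E subn0.
  have [->|m0] := eqVneq m 0%MM; first by rewrite !mnm0E /= !addr0.
  have [m0E|m0E] := posnP (m 0); last first.
    by rewrite mnm_subK // if_same addr0 add0r.
  have [m1E|m1E] := posnP (m 1); last by rewrite mnm_subK // !add0r.
  by case/eqP: m0; apply/mnmP; apply: ord2P; rewrite mnm0E.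
rewrite {1}QE !fps_compD !fps_compM // !fps_compX // fps_compC //.
by rewrite !(tnth_nth 0) /= -[X in X - _]addrA [LHS]addrC addKr.
Qed.

End Ideal.

(** * Normal form of the volume density *)

Theorem corollary1p4 (R : realType) :
  (forall h : fps 4 R, volume_form h ->
     exists (c : R) (p : fps 4 R),
       [/\ 0 < c, in_ideal_f1f2 p &
           formally_equivalent (poisson_of h) (poisson_of (fpsC c + p))]) /\
  (forall (c : R) (p : fps 4 R), 0 < c -> in_ideal_f1f2 p ->
     volume_form (fpsC c + p)).
Proof.
split=> [h h0|c p c0 pI]; last first.
  by rewrite /volume_form fcoefD (in_ideal_const0 pI) addr0 /= eqxx.
have [Q [a [b [hE Ab a0 b0]]]] := real_decomposition h.
have n0 := f1f2_no_const R.
have Ak := fieldA_fibre Q; have Bk := fieldB_fibre Q.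
have lieA0 g := fcoef_lie0 g (@fieldA_no_const R).
have lieB0 g := fcoef_lie0 g (@fieldB_no_const R).
have BA := fieldAB_commute b.
have lieV := @fps_lieV R.
move: hE Ab Ak Bk lieA0 lieB0 BA; set k := fps_comp Q _.
have flow := @fibre_flow R.
move: lieV flow; set A := fps_lie (@fieldA R); set B := fps_lie (@fieldB R).
move=> lieV flow hE Ab Ak Bk A0 B0 BA.
have k0 : fcoef k 0%MM = fcoef h 0%MM by rewrite hE !fcoefD A0 B0 !addr0.
have kvol : volume_form k by rewrite /volume_form k0.
have kU : k \is a GRing.unit by rewrite fps_unitE gt_eqF.
(* Thus [h = m + A a], and [m] is constant along [A] because [A (B b) = B (A b) = 0]; division by
   [m] therefore commutes with [A]. *)
pose m := k + B b.
have mU : m \is a GRing.unit by rewrite fps_unitE fcoefD B0 addr0 gt_eqF.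
have Am : A m = 0 by rewrite /A fps_lieD -/A Ak BA Ab /B fps_lie0 add0r.
have [|| phi [phi0 F1 F2 [J detJ JK]]] := flow (a / m) (b / k).
- by rewrite fcoef0M a0 mul0r.
- by rewrite fcoef0M b0 mul0r.
have Aa : A (a / m) = A a / m := lieV _ _ _ mU Am.
have Bb : B (b / k) = B b / k := lieV _ _ _ kU Bk.
have Abk : A (b / k) = A b / k := lieV _ _ _ kU Ak.
rewrite Aa Bb Abk Ab !mul0r subr0 in detJ.
(* The two factors of the determinant are [h / m] and [m / k], so the product telescopes. *)
have kdet : k * \det J = h.
  have -> : \det J = h / m * (m / k).
    rewrite detJ; congr (_ * _); last by rewrite mulrDl mulrV.
    by rewrite hE addrAC -/m mulrDl mulrV.
  by rewrite [h / m * _]mulrA mulrVK // mulrC mulrVK.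
have [T TE] : exists T : {rmorphism fps 4 R -> fps 4 R},
    (fun g => fps_comp g phi) = T by exists (fps_subst phi0).
have TEE g : fps_comp g phi = T g by rewrite -TE.
(* [phi] fixes [f1] and [f2], hence every series in them. *)
have Tk : T k = k.
  rewrite -TEE /k fps_compA //; congr fps_comp; apply: eq_from_tnth.
  by apply: ord2P; rewrite tnth_mktuple !(tnth_nth 0).
exists (fcoef k 0%MM), (k - fpsC (fcoef k 0%MM)); split.
- by rewrite k0.
- rewrite /k fcoef_comp0 //; exact: Rf1f2_sub_const.
rewrite addrC subrK; exists phi.
  exact: formal_diffeo_jacobian phi0 (mulmx1_unit JK).2.
apply: (pullback_poisson_of h0 kvol phi0 F1 F2).
(* Here [h(phi) = k * \det (J(phi))], and [J(phi)] is inverse to the Jacobian matrix of [phi]. *)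
rewrite TEE -kdet (rmorphM T) Tk -mulrA -det_map_mx -det_mulmx -TE JK.
by rewrite det1 mulr1.
Qed.
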